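(* Let $A\subseteq\mathcal B(H)$ be the $C^*$-algebra constructed in the context (for any choice of the data described there), let $H_\tau$ be the Hilbert space of its faithful tracial GNS representation, and let $H$ be the Hilbert space of the distinguished irreducible representation, namely the inclusion $A\subseteq\mathcal B(H)$. With $\mathfrak c=2^{\aleph_0}$, $$|A|=\operatorname{dens}(A)=\mathfrak c,\qquad \operatorname{dens}(H)=\mathfrak c,\qquad H_\tau\text{ is separable and infinite-dimensional}.$$ Consequently, $H_\tau$ has a countably infinite orthonormal basis, whereas every orthonormal basis of $H$ has cardinality $\mathfrak c$.
   Context: Conventions. Algebras and Hilbert spaces are complex; inner products are linear in the first variable; for vectors $x,y$, $\theta_{x,y}z=\langle z,y\rangle x$. Strong limits are limits in the strong operator topology. $\operatorname{dens}(X)$ is the density character of a topological space $X$ (least cardinality of a dense subset); $A$ and $H$ carry their norm topologies. CAR algebra. $C=\overline{\bigcup_{n\ge0}C_n}$ with $C_n=M_2(\mathbb C)^{\otimes n}$ embedded in $C_{n+1}$ by $a\mapsto a\otimes1_2$. Its unique tracial state is $\tau(a)=2^{-n}\operatorname{Tr}(a)$, $a\in C_n$. Let $e_{00}\in M_2(\mathbb C)$ be the first diagonal matrix unit, $q_n=e_{00}^{\otimes n}\in C$ (so $q_0=1$ and $q_n$ is decreasing), and let $\phi_{\mathrm r}$ be the pure product state of $C$ selecting the first coordinate in each tensor factor, i.e. the product of the vector states $a\mapsto a_{00}$ on $M_2(\mathbb C)$. Pure-state data. Choose pure states $(\phi_i)_{i\in I}$ of $C$, with GNS triples $(H_i,\pi_i,\xi_i)$,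 such that $(\pi_i)_{i\in I}$ contains exactly one representative of each unitary equivalence class of irreducible representations of $C$, with a distinguished index $\mathrm r\in I$ corresponding to $\phi_{\mathrm r}$. For each $i\in I$ choose an automorphism $\alpha_i$ of $C$ with $\phi_i\circ\alpha_i=\phi_{\mathrm r}$ and $\alpha_{\mathrm r}=\mathrm{id}_C$ which is asymptotically inner: there is a norm-continuous path $t\mapsto u_{i,t}$ ($t\ge0$) of unitaries of $C$ with $u_{i,0}=1$ and $\lim_{t\to\infty}\|\alpha_i(a)-u_{i,t}au_{i,t}^*\|=0$ for all $a\in C$. (Such $\alpha_i$ exist by the Kishimoto–Ozawa–Sakai homogeneity theorem.) Put, for $n\ge0$, $p_{i,n}=\alpha_i(q_n)$, $f_n=q_n-q_{n+1}$, $e_{i,n}=p_{i,n}-p_{i,n+1}$. Choose $w_{i,n}\in C$ with $w_{i,n}^*w_{i,n}=e_{i,n}$, $w_{i,n}w_{i,n}^*=f_n$, $w_{\mathrm r,n}=f_n$ (such elements exist), and put $s_{i,N}=\sum_{n=0}^{N-1}w_{i,n}\in C$. The algebra. Let $H=\bigoplus_{i\in I}H_i$, $\Pi=\bigoplus_{i\in I}\pi_i:C\to\mathcal B(H)$, and let $\zeta_i\in H$ be the image of $\xi_i$ under the coordinate inclusion $H_i\to H$. Let $S_i$ be the strong limit of $\Pi(s_{i,N})$ as $N\to\infty$ (which exists) and $L_i=S_i+\theta_{\zeta_{\mathrm r},\zeta_i}$, which is a unitary on $H$. Define $A=C^*(\Pi(C),\{L_i:i\in I\})\subseteq\mathcal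 B(H)$, and $j:C\to A$, $j(a)=\Pi(a)$. Tracial representation. $A$ has a unique tracial state $\widetilde\tau$; it is faithful and is the unique state of $A$ with $\widetilde\tau\circ j=\tau$. Let $(K,\rho,\Omega)$ be its GNS triple and $(H_\tau,\pi_\tau,\Omega_\tau)$ the GNS triple of $\tau$ on $C$. The map $\pi_\tau(b)\Omega_\tau\mapsto\rho(j(b))\Omega$ ($b\in C$) extends to a unitary $H_\tau\to K$, through which $H_\tau$ is regarded as the space of the faithful tracial GNS representation of $A$. *)

(* Defs.v *)
From HB Require Import structures.
From mathcomp Require Import all_boot all_order all_algebra.
From mathcomp Require Import sesquilinear complex mxtens.
From mathcomp Require Import all_classical all_reals all_analysis.

Set Implicit Arguments.
Unset Strict Implicit.
Unset Printing Implicit Defensive.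

Import Order.TTheory GRing.Theory Num.Theory Num.Def.
Import numFieldNormedType.Exports.

Local Open Scope classical_set_scope.
Local Open Scope card_scope.
Local Open Scope ring_scope.
Local Open Scope complex_scope.

(* Hilbert spaces over the complex numbers R[i], where R is any model of the
   reals.  The form is linear in the first variable. *)
HB.mixin Record isHilbert (R : realType) H of CompleteNormedModule R[i] H := {
  inner : {dot H for (@conjC R[i])};
  innerxx : forall x : H, inner x x = `|x| ^+ 2
}.

#[short(type="hilbertType")]
HB.structure Definition Hilbert (R : realType) :=
  {H of isHilbert R H & CompleteNormedModule R[i] H}.

(* Nonzero unital complex C*-algebras.  MathComp cannot declare the join of
   completeNormedModType and algType below numDomainType, so the product is
   bundled in a record and the algType structure is put on its carrier. *)
Record cstarAlgType (R : realType) := CStarAlg {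
  cstar_base : completeNormedModType R[i];
  cstar_one : cstar_base;
  cstar_mul : cstar_base -> cstar_base -> cstar_base;
  cstar_inv : cstar_base -> cstar_base;
  cstar_mulA : associative cstar_mul;
  cstar_mul1l : left_id cstar_one cstar_mul;
  cstar_mul1r : right_id cstar_one cstar_mul;
  cstar_mulDl : left_distributive cstar_mul +%R;
  cstar_mulDr : right_distributive cstar_mul +%R;
  cstar_oner_neq0 : cstar_one != 0;
  cstar_scaleAl : forall (c : R[i]) a b,
    c *: cstar_mul a b = cstar_mul (c *: a) b;
  cstar_scaleAr : forall (c : R[i]) a b,
    c *: cstar_mul a b = cstar_mul a (c *: b);
  cstar_invK : involutive cstar_inv;
  cstar_inv_antilinear : forall (c : R[i]) a b,
    cstar_inv (c *: a + b) = conjC c *: cstar_inv a + cstar_inv b;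
  cstar_invM : forall a b,
    cstar_inv (cstar_mul a b) = cstar_mul (cstar_inv b) (cstar_inv a);
  cstar_normM_le : forall a b, `|cstar_mul a b| <= `|a| * `|b|;
  cstar_norm_starM : forall a, `|cstar_mul (cstar_inv a) a| = `|a| ^+ 2
}.

Definition cstar_sort (R : realType) (A : cstarAlgType R) : Type :=
  cstar_base A.
Coercion cstar_sort : cstarAlgType >-> Sortclass.

HB.instance Definition _ (R : realType) (A : cstarAlgType R) :=
  CompleteNormedModule.copy (cstar_sort A) (cstar_base A).
HB.instance Definition _ (R : realType) (A : cstarAlgType R) :=
  GRing.Zmodule_isNzRing.Build (cstar_sort A) (@cstar_mulA R A)
    (@cstar_mul1l R A) (@cstar_mul1r R A) (@cstar_mulDl R A)
    (@cstar_mulDr R A) (@cstar_oner_neq0 R A).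
HB.instance Definition _ (R : realType) (A : cstarAlgType R) :=
  GRing.Lmodule_isLalgebra.Build R[i] (cstar_sort A) (@cstar_scaleAl R A).
HB.instance Definition _ (R : realType) (A : cstarAlgType R) :=
  GRing.Lalgebra_isAlgebra.Build R[i] (cstar_sort A) (@cstar_scaleAr R A).

Definition star (R : realType) (A : cstarAlgType R) (a : A) : A :=
  cstar_inv a.

Definition is_subspace (K : numFieldType) (V : lmodType K) (W : set V) : Prop :=
  W 0 /\ forall (c : K) x y, W x -> W y -> W (c *: x + y).

Definition linear_span (K : numFieldType) (V : lmodType K) (E : set V) : set V :=
  smallest (@is_subspace K V) E.

Definition infinite_dimensional (K : numFieldType) (V : lmodType K) : Prop :=
  ~ exists n, exists e : 'I_n -> V, linear_span (range e) = setT.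

Definition separable_space (T : topologicalType) : Prop :=
  exists2 D : set T, countable D & dense D.

(* The density character of T is the cardinality of the set k. *)
Definition density_character_eq (T : topologicalType) (U : Type) (k : set U)
    : Prop :=
  (exists2 D : set T, dense D & D #= k) /\
  forall D : set T, dense D -> k #<= D.

(* A set of cardinality 2 ^ aleph_0. *)
Definition continuum : set (set nat) := [set: set nat].

Definition orthonormal_basis (R : realType) (H : hilbertType R) (B : set H)
    : Prop :=
  (forall x y, B x -> B y -> inner x y = (x == y)%:R) /\ dense (linear_span B).

Definition is_unitary_op (R : realType) (H K : hilbertType R) (U : H -> K)
    : Prop :=
  [/\ linear U, (forall x y, inner (U x) (U y) = inner x y)
    & forall y, exists x, U x = y].

Definition bounded_operator (R : realType) (H : hilbertType R) (T : H -> H)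
    : Prop :=
  linear T /\ continuous T.

Definition are_adjoint (R : realType) (H : hilbertType R) (T T' : H -> H)
    : Prop :=
  forall x y, inner (T x) y = inner x (T' y).

Definition theta_op (R : realType) (H : hilbertType R) (x y : H) : H -> H :=
  fun z => inner z y *: x.

(* M is the operator norm of T. *)
Definition is_operator_norm (R : realType) (H : hilbertType R) (T : H -> H)
    (M : R[i]) : Prop :=
  [/\ 0 <= M, (forall x, `|T x| <= M * `|x|)
    & forall M' : R[i], 0 <= M' -> (forall x, `|T x| <= M' * `|x|) -> M <= M'].

(* V exhibits H as the Hilbert space direct sum of the family Hs. *)
Definition is_hilbert_sum (R : realType) (I : Type) (Hs : I -> hilbertType R)
    (H : hilbertType R) (V : forall i, Hs i -> H) : Prop :=
  [/\ (forall i, linear (V i)),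
      (forall i x y, inner (V i x) (V i y) = inner x y),
      (forall i k x y, i <> k -> inner (V i x) (V k y) = 0)
    & dense (linear_span (\bigcup_i range (V i)))].

(* Norm-closed *-subalgebras of B(H). *)
Definition is_cstar_subalgebra (R : realType) (H : hilbertType R)
    (B : set (H -> H)) : Prop :=
  [/\ (forall T, B T -> bounded_operator T),
      (forall (c : R[i]) T T', B T -> B T' -> B (fun x => c *: T x + T' x)),
      (forall T T', B T -> B T' -> B (T \o T')),
      (forall T T', B T -> are_adjoint T T' -> B T')
    & forall T, (forall e : R[i], 0 < e ->
          exists2 T', B T' & forall x, `|T x - T' x| <= e * `|x|) -> B T].

Definition cstar_generated (R : realType) (H : hilbertType R)
    (G : set (H -> H)) : set (H -> H) :=
  smallest (@is_cstar_subalgebra R H) G.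

Record is_representation (R : realType) (A : cstarAlgType R)
    (H : hilbertType R) (pi : A -> H -> H) : Prop := {
  rep_bounded : forall a, bounded_operator (pi a);
  rep_linear : forall x, linear (fun a => pi a x);
  rep_one : forall x, pi 1 x = x;
  rep_mul : forall a b x, pi (a * b) x = pi a (pi b x);
  rep_star : forall a, are_adjoint (pi a) (pi (star a))
}.

(* iota identifies the C*-algebra A with the concrete C*-algebra B of bounded
   operators on H, carrying the operator norm. *)
Definition is_concrete_cstar (R : realType) (A : cstarAlgType R)
    (H : hilbertType R) (iota : A -> H -> H) (B : set (H -> H)) : Prop :=
  [/\ is_representation iota, (forall a, is_operator_norm (iota a) `|a|)
    & range iota = B].

Definition irreducible_rep (R : realType) (A : cstarAlgType R)
    (H : hilbertType R) (pi : A -> H -> H) : Prop :=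
  [/\ is_representation pi, (exists x : H, x != 0)
    & forall W : set H, is_subspace W -> closed W ->
        (forall a x, W x -> W (pi a x)) -> W = [set 0] \/ W = setT].

Definition unitarily_equivalent (R : realType) (A : cstarAlgType R)
    (H K : hilbertType R) (pi : A -> H -> H) (sigma : A -> K -> K) : Prop :=
  exists2 U : H -> K, is_unitary_op U
    & forall a x, U (pi a x) = sigma a (U x).

Definition is_state (R : realType) (A : cstarAlgType R) (phi : A -> R[i])
    : Prop :=
  [/\ scalar phi, (forall a, 0 <= phi (star a * a)) & phi 1 = 1].

Definition is_pure_state (R : realType) (A : cstarAlgType R)
    (phi : A -> R[i]) : Prop :=
  is_state phi /\
  forall (psi1 psi2 : A -> R[i]) (t : R),
    is_state psi1 -> is_state psi2 -> 0 < t < 1 ->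
    (forall a, phi a = t%:C * psi1 a + (1 - t)%:C * psi2 a) ->
    psi1 =1 phi /\ psi2 =1 phi.

Definition is_tracial_state (R : realType) (A : cstarAlgType R)
    (tau : A -> R[i]) : Prop :=
  is_state tau /\ forall a b, tau (a * b) = tau (b * a).

Definition is_GNS_triple (R : realType) (A : cstarAlgType R)
    (phi : A -> R[i]) (H : hilbertType R) (pi : A -> H -> H) (xi : H) : Prop :=
  [/\ is_representation pi, dense (range (fun a => pi a xi))
    & forall a, phi a = inner (pi a xi) xi].

Definition is_unitary (R : realType) (A : cstarAlgType R) (u : A) : Prop :=
  star u * u = 1 /\ u * star u = 1.

Definition is_automorphism (R : realType) (A : cstarAlgType R)
    (f : {lrmorphism A -> A}) : Prop :=
  bijective f /\ forall a, f (star a) = star (f a).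

Definition asymptotically_inner (R : realType) (A : cstarAlgType R)
    (f : A -> A) : Prop :=
  exists u : R -> A,
    [/\ {within `[0, +oo[, continuous u},
        (forall t, 0 <= t -> is_unitary (u t)),
        u 0 = 1
      & forall a, u t * a * star (u t) @[t --> +oo] --> f a].

(* Matrix of a (x) b, identifying C^(2^n) (x) C^2 with C^(2^(n+1)). *)
Definition tensor_step (K : comNzRingType) n (a : 'M[K]_(2 ^ n)) (b : 'M[K]_2)
    : 'M[K]_(2 ^ n.+1) :=
  castmx (esym (expnSr 2 n), esym (expnSr 2 n)) (a *t b).

(* a 0 (x) a 1 (x) ... (x) a (n - 1) *)
Fixpoint tensor_prod (K : comNzRingType) (a : nat -> 'M[K]_2) n
    : 'M[K]_(2 ^ n) :=
  if n is m.+1 then tensor_step (tensor_prod a m) (a m) else 1%:M.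

(* The CAR algebra, as the completed inductive limit of the algebras
   M_2(C)^{(x) n} = M_{2^n}(C) along a |-> a (x) 1. *)
Record CARalgebra (R : realType) := {
  CAR_alg :> cstarAlgType R;
  emb : forall n, {linear 'M[R[i]]_(2 ^ n) -> CAR_alg};
  emb_inj : forall n, injective (emb n);
  emb_one : forall n, emb n 1%:M = 1;
  emb_mul : forall n a b, emb n (a *m b) = emb n a * emb n b;
  emb_star : forall n a, emb n (map_mx conjC a^T) = star (emb n a);
  emb_step : forall n a, emb n.+1 (tensor_step a 1%:M) = emb n a;
  emb_dense : dense (\bigcup_n range (emb n))
}.

Definition is_CAR_trace (R : realType) (C : CARalgebra R) (tau : C -> R[i])
    : Prop :=
  is_tracial_state tau /\
  forall n (a : 'M[R[i]]_(2 ^ n)), tau (emb C n a) = (2 ^+ n)^-1 * \tr a.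

Definition is_zero_product_state (R : realType) (C : CARalgebra R)
    (phi : C -> R[i]) : Prop :=
  is_state phi /\
  forall n (a : nat -> 'M[R[i]]_2),
    phi (emb C n (tensor_prod a n)) = \prod_(k < n) a k ord0 ord0.

Definition q_ (R : realType) (C : CARalgebra R) n : C :=
  emb C n (tensor_prod (fun=> delta_mx ord0 ord0) n).

Definition f_ (R : realType) (C : CARalgebra R) n : C := q_ C n - q_ C n.+1.

Record pureStateData (R : realType) (C : CARalgebra R) := {
  psI : Type;
  psr : psI;
  ps_phi : psI -> C -> R[i];
  ps_phi_pure : forall i, is_pure_state (ps_phi i);
  ps_phi_r : is_zero_product_state (ps_phi psr);
  ps_H : psI -> hilbertType R;
  ps_pi : forall i, C -> ps_H i -> ps_H i;
  ps_xi : forall i, ps_H i;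
  ps_GNS : forall i, is_GNS_triple (ps_phi i) (@ps_pi i) (ps_xi i);
  ps_transversal : forall (K : hilbertType R) (sigma : C -> K -> K),
    irreducible_rep sigma ->
    exists! i, unitarily_equivalent (@ps_pi i) sigma;
  ps_alpha : psI -> {lrmorphism C -> C};
  ps_alpha_aut : forall i, is_automorphism (ps_alpha i);
  ps_alpha_inner : forall i, asymptotically_inner (ps_alpha i);
  ps_alpha_phi : forall i a, ps_phi i (ps_alpha i a) = ps_phi psr a;
  ps_alpha_r : forall a, ps_alpha psr a = a;
  ps_w : psI -> nat -> C;
  ps_w_source : forall i n,
    star (ps_w i n) * ps_w i n
    = ps_alpha i (q_ C n) - ps_alpha i (q_ C n.+1);
  ps_w_range : forall i n, ps_w i n * star (ps_w i n) = f_ C n;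
  ps_w_r : forall n, ps_w psr n = f_ C n
}.

Definition s_ (R : realType) (C : CARalgebra R) (D : pureStateData C)
    (i : psI D) (N : nat) : C :=
  \sum_(0 <= n < N) ps_w i n.

Definition L_ (R : realType) (C : CARalgebra R) (D : pureStateData C)
    (H : hilbertType R) (V : forall i : psI D, ps_H i -> H)
    (S : psI D -> H -> H) (i : psI D) : H -> H :=
  fun x => S i x + theta_op (V (psr D) (ps_xi (psr D))) (V i (ps_xi i)) x.

(* Main.v *)
Require Import Defs.
From HB Require Import structures.
From mathcomp Require Import all_boot all_order all_algebra.
From mathcomp Require Import sesquilinear complex mxtens.
From mathcomp Require Import all_classical all_reals all_analysis.
Import Order.TTheory GRing.Theory Num.Theory Num.Def.
Import numFieldNormedType.Exports.
Local Open Scope classical_set_scope.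
Local Open Scope card_scope.
Local Open Scope ring_scope.
Local Open Scope complex_scope.

Set Implicit Arguments.
Unset Strict Implicit.
Unset Printing Implicit Defensive.

(** Every cardinality in the statement reduces to that of the index set [I] of
    inequivalent irreducible representations of the CAR algebra [C], together
    with the fact that a metric space with a dense subset of at most continuum
    many points has at most continuum many points.

    [I] has at least continuum many elements. A bit sequence [z] gives an
    automorphism of [C], the infinite tensor product of the bit flips at the
    sites selected by [z]; composing it with the irreducible representation of
    the product state [phi_r] gives an irreducible representation. Sequences
    that differ infinitely often give inequivalent representations
    ([flip_inequivalent]), and there are continuum many such sequences. The
    irreducibility is proved from the projections [q_n], which converge
    strongly to the projection onto the cyclic vector
    ([zero_state_irreducible]).

    [I] has at most continuum many elements. The representation indexed by [i]
    is the GNS representation of the state determined by [alpha_i]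
    ([GNS_unique]), and [alpha_i], a pointwise limit of inner automorphisms,
    is contractive, hence determined by its values on the countably many
    matrix units ([ps_alpha_ext]).

    The upper bounds for [H] and [A] follow: [H] is the closed span of
    continuum many pieces with at most continuum many points each, and [A] has
    a dense star-subalgebra obtained from continuum many generators by
    countably many rounds of algebraic operations. The lower bounds come from
    families indexed by [I] with mutual distances at least [1]: the unit
    vectors [zeta_i] in [H], and the operators [L_i] in [A], because the
    matrix coefficient of [L_i - L_k] from [zeta_i] to [zeta_r] is [1]
    ([L_separated]).

    A separated family only bounds dense sets from below. To bound an
    orthonormal basis [B] of [H], each [zeta_i] is sent to an element of [B]
    to which it is not orthogonal; by Bessel's inequality the fibres of this
    map are countable, and a diagonal argument shows that a map from the
    continuum with countable fibres has an image of the cardinality of the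
    continuum ([continuum_koenig]).

    Finally, the vectors of the tracial representation are approximated by
    those coming from matrices with rational entries, and the reflections
    [diag(1, -1)] at the different sites are orthonormal for the trace. Hence
    [H_tau] is separable and infinite-dimensional, and the Gram-Schmidt
    process provides a countably infinite orthonormal basis. The continuity
    needed here, as well as above, is that of representations ([rep_norm_le]),
    proved by extracting a square root with a contraction argument. *)

(** * Sets with at most continuum many elements *)

(** Codes in the Cantor space, rather than a cardinal inequality, because they
    can be paired, prefixed and interleaved directly. *)
Definition le_continuum (T : Type) (X : set T) : Prop :=
  exists code : T -> nat -> bool,
    forall x y, X x -> X y -> code x = code y -> x = y.

Lemma card_le_setP (T U : Type) (X : set T) (Y : set U) (g : T -> U) :
  (forall x, X x -> Y (g x)) ->
  (forall x y, X x -> X y -> g x = g y -> x = y) -> X #<= Y.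
Proof.
move=> gY gI; apply: (card_le_trans (B := g @` X)); last first.
  by apply: subset_card_le => _ [x Xx <-]; exact: gY.
suff /card_esym : (g @` X #= X) by rewrite card_eq_le => /andP[].
apply: inj_card_eq => x y /set_mem Xx /set_mem Xy; exact: gI.
Qed.

Lemma le_continuum_card (T : Type) (X : set T) :
  le_continuum X -> X #<= continuum.
Proof.
move=> [code codeI].
apply: (card_le_setP (g := fun x => [set n | code x n])) => // x y Xx Xy exy.
apply: codeI => //; apply/funext => n.
have : [set n | code x n] n = [set n | code y n] n by rewrite exy.
by move=> /= e; apply/idP/idP; rewrite e.
Qed.

Lemma continuum_card_le (T : Type) (X : set T) (g : (nat -> bool) -> T) :
  (forall x, X (g x)) -> injective g -> continuum #<= X.
Proof.
move=> gX gI.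
apply: (card_le_setP (g := fun A : set nat => g (fun n => `[< A n >]))) => //.
move=> A B _ _ /gI /(congr1 (fun f => f _)) e; apply/seteqP; split => n.
  by move=> An; apply/asboolP; have /asboolP := An; rewrite -e.
by move=> An; apply/asboolP; have /asboolP := An; rewrite -e.
Qed.

Lemma card_continuum (T : Type) (X : set T) :
  le_continuum X -> continuum #<= X -> X #= continuum.
Proof. by move=> /le_continuum_card X1 X2; rewrite card_eq_le X1. Qed.

Lemma le_continuum_sub (T : Type) (X Y : set T) :
  X `<=` Y -> le_continuum Y -> le_continuum X.
Proof.
move=> XY [code codeI]; exists code => x y /XY Yx /XY Yy; exact: codeI.
Qed.

(** Objects may be coded by non-unique data, such as a sequence converging to
    them, provided that the data determine the object. *)
Lemma le_continuum_rel (T U : Type) (X : set T) (Y : set U)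
    (r : T -> U -> Prop) :
  le_continuum Y ->
  (forall x, X x -> exists2 u, Y u & r x u) ->
  (forall x y u, X x -> X y -> r x u -> r y u -> x = y) ->
  le_continuum X.
Proof.
move=> [code codeI] tot inj.
exists (fun x => if pselect (X x) is left Xx then code (s2val (cid2 (tot x Xx)))
                 else fun=> false).
move=> x y Xx Xy; case: pselect => // {}Xx; case: pselect => // {}Xy.
case: cid2 => u Yu xu; case: cid2 => v Yv yv /= /codeI uv.
by apply: (inj _ _ u) => //; rewrite uv.
Qed.

Lemma le_continuum_image (T U : Type) (X : set T) (f : T -> U) :
  le_continuum X -> le_continuum (f @` X).
Proof.
move=> leX; apply: (le_continuum_rel (r := fun y x => f x = y) leX).
  by move=> _ [x Xx <-]; exists x.
by move=> _ _ x _ _ <- <-.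
Qed.

Lemma le_continuum_inj (T U : Type) (X : set T) (Y : set U) (f : T -> U) :
  le_continuum Y -> (forall x, X x -> Y (f x)) ->
  (forall x y, X x -> X y -> f x = f y -> x = y) -> le_continuum X.
Proof.
move=> leY fY fI; apply: (le_continuum_rel (r := fun x y => f x = y) leY).
  by move=> x Xx; exists (f x) => //; exact: fY.
by move=> x y _ Xx Xy <- /esym; exact: fI.
Qed.

Lemma le_continuum_seq (T : Type) (X : set T) :
  le_continuum X -> le_continuum [set g : nat -> T | forall n, X (g n)].
Proof.
move=> [code codeI].
exists (fun g n => let p := odflt (0, 0)%N (unpickle n) in code (g p.1) p.2).
move=> g h Xg Xh e; apply/funext => n; apply: codeI => //.
apply/funext => m; move/(congr1 (fun f => f (pickle (n, m)))): e.
by rewrite pickleK.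
Qed.

Lemma le_continuum_bool : le_continuum [set: bool].
Proof. by exists (fun b _ => b) => x y _ _ /(congr1 (fun f => f 0%N)). Qed.

Lemma le_continuum_countType (T : countType) (X : set T) : le_continuum X.
Proof.
exists (fun x n => n == pickle x) => x y _ _.
move=> /(congr1 (fun f => f (pickle y))) /=; rewrite eqxx => /eqP.
by move/(pcan_inj pickleK).
Qed.

Lemma le_continuum_bigcup (J T : Type) (Z : set J) (F : J -> set T) :
  le_continuum Z -> (forall j, Z j -> le_continuum (F j)) ->
  le_continuum (\bigcup_(j in Z) F j).
Proof.
move=> [codeZ codeZI] leF.
have /choice[c cI] : forall j, exists c : T -> nat -> bool,
    Z j -> forall x y, F j x -> F j y -> c x = c y -> x = y.
  move=> j; have [/leF[c cI]|nZ] := pselect (Z j); first by exists c.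
  by exists (fun _ _ => false) => /nZ.
have le2 : le_continuum
    [set g : nat -> nat -> bool | forall n, [set: nat -> bool] (g n)].
  by apply: le_continuum_seq; exists id.
apply: (le_continuum_rel
  (r := fun x g => exists2 j, Z j & F j x /\ g = (fun n => if n is 0%N then
                                               codeZ j else c j x)) le2).
  by move=> x [j Zj Fjx]; eexists; last by exists j.
move=> x y _ _ _ [j Zj [Fx ->]] [k Zk [Fy e]].
have jk : j = k.
  by apply: codeZI => //; have := congr1 (fun f => f 0%N) e.
rewrite {}jk {Zj} in Fx e; apply: cI Fx Fy _ => //.
by have := congr1 (fun f => f 1%N) e.
Qed.

Lemma le_continuum_setX (T U : Type) (X : set T) (Y : set U) :
  le_continuum X -> le_continuum Y -> le_continuum (X `*` Y).
Proof.
move=> leX leY.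
apply: (@le_continuum_sub _ _ (\bigcup_(x in X) ((fun y => (x, y)) @` Y))).
  by move=> [x y] [/= Xx Yy]; exists x => //; exists y.
by apply: le_continuum_bigcup => // x _; exact: le_continuum_image.
Qed.

(** A real number is determined by the rationals below it. *)
Lemma le_continuum_real (R : realType) : le_continuum [set: R].
Proof.
have le1 : le_continuum
    [set g : rat -> bool | True].
  apply: (@le_continuum_rel _ _ _ [set: nat -> bool]
    (fun g h => forall q, h (pickle q) = g q)).
  - by exists id.
  - move=> g _; exists (fun n => oapp g false (unpickle n)) => //.
    by move=> q; rewrite pickleK.
  - by move=> g g' h _ _ hg hg'; apply/funext => q; rewrite -hg -hg'.
apply: (le_continuum_inj (f := fun (x : R) (q : rat) => ratr q < x) le1) => //.
move=> x y _ _ e; apply/eqP; rewrite eq_le; apply/andP; split; rewrite leNgt;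
  apply/negP => /rat_in_itvoo[q]; rewrite in_itv/= => /andP[q1 q2].
  have := congr1 (fun f => f q) e; rewrite q2 => /esym q3.
  by have := lt_trans q1 q3; rewrite ltxx.
have := congr1 (fun f => f q) e; rewrite q2 => q3.
by have := lt_trans q1 q3; rewrite ltxx.
Qed.

Lemma le_continuum_complex (R : realType) : le_continuum [set: R[i]].
Proof.
have leR := le_continuum_real R.
apply: (le_continuum_inj (f := fun z : R[i] => (complex.Re z, complex.Im z))
  (le_continuum_setX leR leR)) => //.
by move=> [a b] [c d] _ _ [-> ->].
Qed.

(** Closing up takes countably many rounds, each of which adds the images of at
    most continuum many triples. The parameter in [P] makes [op] stand for a
    whole family of operations. *)
Lemma le_continuum_closure (P T : Type) (op : P -> T -> T -> T) (X : set T) :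
  le_continuum [set: P] -> le_continuum X ->
  exists Y : set T, [/\ X `<=` Y, le_continuum Y &
    forall p x y, Y x -> Y y -> Y (op p x y)].
Proof.
move=> leP leX.
pose step Z := Z `|` (fun p => op p.1 p.2.1 p.2.2) @` (setT `*` (Z `*` Z)).
pose stage n := iter n step X.
have stage_le n m : (n <= m)%N -> stage n `<=` stage m.
  elim: m => [|m IH]; first by rewrite leqn0 => /eqP ->.
  by rewrite leq_eqVlt => /predU1P[->//|/IH sub] x /sub; left.
exists (\bigcup_n stage n); split.
- by move=> x Xx; exists 0%N.
- apply: le_continuum_bigcup => [|n _]; first exact: le_continuum_countType.
  elim: n => //= n IH.
  pose F (b : bool) := if b then stage n
    else (fun p => op p.1 p.2.1 p.2.2) @` (setT `*` (stage n `*` stage n)).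
  apply: (@le_continuum_sub _ _ (\bigcup_b F b)).
    by move=> x [] sx; [exists true|exists false].
  apply: le_continuum_bigcup => [|[] _ //]; first exact: le_continuum_bool.
  by apply/le_continuum_image/le_continuum_setX => //; exact: le_continuum_setX.
- move=> p x y [n _ nx] [m _ my]; exists (maxn n m).+1 => //; right.
  exists (p, (x, y)) => //; split => //; split.
    by apply: stage_le nx; exact: leq_maxl.
  by apply: stage_le my; exact: leq_maxr.
Qed.

(** Koenig's diagonal argument: splitting the continuum, written as a countable
    power of itself, into countably many pieces, some piece projects onto its
    own coordinate, for otherwise a point avoiding all these projections would
    lie in no piece. *)
Lemma continuum_koenig (T : Type) (X : set T) (g : (nat -> bool) -> T)
    (k : (nat -> bool) -> nat) :
  (forall x, X (g x)) -> (forall x y, g x = g y -> k x = k y -> x = y) ->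
  continuum #<= X.
Proof.
move=> gX gkI.
pose row (n : nat) (x : nat -> bool) (m : nat) := x (pickle (n, m)).
have [[n nS]|nS] :=
    pselect (exists n, forall y, exists2 x, k x = n & row n x = y).
  have /choice[h hP] : forall y, exists x, k x = n /\ row n x = y.
    by move=> y; have [x ? ?] := nS y; exists x.
  apply: (continuum_card_le (g := g \o h)) => [x|x y /= e]; first exact: gX.
  have [kx <-] := hP x; have [ky <-] := hP y.
  by congr row; apply: gkI => //; rewrite kx ky.
have /choice[d dP] : forall n, exists y, forall x, k x = n -> row n x <> y.
  move=> n; apply: contrapT => /forallNP nE; apply: nS; exists n => y.
  by have /existsNP[x /not_implyP[kx /contrapT e]] := nE y; exists x.
pose x m := let p := odflt (0, 0)%N (unpickle m) in d p.1 p.2.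
by case: (dP (k x) x erefl); apply/funext => m; rewrite /row /x pickleK.
Qed.

(** * Sequences and density over the complex numbers *)

Lemma complex_arch (R : realType) (e : R[i]) :
  0 < e -> exists n, n.+1%:R^-1 < e.
Proof.
(* in the order of the complex numbers, positive elements are real *)
move=> e0; have er : e = (complex.Re e)%:C.
  by case: e e0 => a b; rewrite ltcE /= => /andP[/eqP ->].
have r0 : 0 < complex.Re e by move: e0; rewrite er ltcR.
have [n nP] : exists n : nat, (complex.Re e)^-1 < n%:R.
  by exists (Num.truncn (complex.Re e)^-1).+1; exact: truncnS_gt.
exists n; rewrite er -(rmorph_nat (real_complex R)) -fmorphV ltcR.
rewrite invf_plt ?posrE ?ltr0n//; apply: (lt_trans nP).
by rewrite ltr_nat.
Qed.

Lemma invn_le_complex (R : realType) (n m : nat) :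
  (n <= m)%N -> m.+1%:R^-1 <= n.+1%:R^-1 :> R[i].
Proof.
by move=> nm; rewrite lef_pV2 ?posrE ?ltr0n// ler_nat.
Qed.

Lemma cvg_seqP (R : realType) (E : normedModType R[i]) (u : nat -> E) (l : E) :
  (u n @[n --> \oo] --> l) <->
  (forall e : R[i], 0 < e -> exists N, forall n, (N <= n)%N -> `|l - u n| < e).
Proof.
split=> [/cvgrPdist_lt ul e e0|ul].
  by have [N _ NP] := ul e e0; exists N => n; exact: NP.
by apply/cvgrPdist_lt => e /ul[N NP]; exists N.
Qed.

Lemma complete_seq (R : realType) (E : completeNormedModType R[i])
    (u : nat -> E) :
  (forall e : R[i], 0 < e -> exists N, forall n m,
     (N <= n)%N -> (N <= m)%N -> `|u n - u m| < e) ->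
  exists l : E, u n @[n --> \oo] --> l.
Proof.
move=> uc; exists (limn u).
apply/cauchy_cvgP/cauchy_ballP => e e0.
have [N NP] := uc e e0.
exists (u @` [set n | (N <= n)%N], u @` [set n | (N <= n)%N]).
  by split; exists N => // n Nn; exists n.
by move=> [_ _] [/= [n Nn <-] [m Nm <-]]; rewrite -ball_normE /=; exact: NP.
Qed.

Lemma le_lim (R : realType) (E : normedModType R[i]) (u : nat -> E) (l a : E)
    (M : R[i]) :
  (u n @[n --> \oo] --> l) ->
  (exists N, forall n, (N <= n)%N -> `|a - u n| <= M) ->
  `|a - l| <= M.
Proof.
move=> /cvg_seqP ul [N NP]; apply/ler_addgt0Pr => e e0.
have [N' NP'] := ul e e0.
rewrite -[a - l](subrKA (u (maxn N N'))) (le_trans (ler_normD _ _))//.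
rewrite lerD ?NP ?leq_maxl// distrC; apply/ltW/NP'; exact: leq_maxr.
Qed.

Lemma dense_approxP (R : realType) (E : normedModType R[i]) (D : set E) :
  dense D <-> (forall x (e : R[i]), 0 < e -> exists2 d, D d & `|x - d| < e).
Proof.
split=> [Dd x e e0|DP U [x Ux] oU].
  have [|d [xd Dd']] := Dd (ball x e) _ (ball_open _ _).
    by exists x; exact: ballxx.
  by exists d => //; move: xd; rewrite -ball_normE.
have : nbhs x U by exact: open_nbhs_nbhs.
move=> /nbhs_ballP[e /= e0 eU]; have [d Dd xd] := DP x e e0.
by exists d; split => //; apply: eU; rewrite -ball_normE.
Qed.

Lemma eq_dist (R : realType) (E : normedModType R[i]) (x y : E) :
  (forall e : R[i], 0 < e -> `|x - y| <= e) -> x = y.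
Proof.
move=> H; apply/eqP; rewrite -subr_eq0 -normr_eq0.
apply/negPn/negP => n0; have p : 0 < `|x - y| by rewrite lt_neqAle eq_sym n0 /=.
have := H _ (divr_gt0 p (ltr0n _ 2)).
by rewrite ler_pdivlMr ?ltr0n// ger_pMr// (ler_nat _ 2 1).
Qed.

Lemma seq_lim_unique (R : realType) (E : normedModType R[i]) (u : nat -> E)
    (l l' : E) :
  (u n @[n --> \oo] --> l) -> (u n @[n --> \oo] --> l') -> l = l'.
Proof. by move=> ul ul'; apply: cvg_unique ul ul'; exact: norm_hausdorff. Qed.

(** Every point is the limit of a sequence in the dense set. *)
Lemma le_continuum_dense (R : realType) (E : normedModType R[i]) (D : set E) :
  dense D -> le_continuum D -> le_continuum [set: E].
Proof.
move=> /dense_approxP Dd /le_continuum_seq leD.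
apply: (le_continuum_rel (r := fun x (u : nat -> E) =>
   forall n, `|x - u n| < n.+1%:R^-1) leD).
  move=> x _.
  have /choice[u uP] : forall n, exists d, D d /\ `|x - d| < n.+1%:R^-1.
    move=> n; have [|d Dd' xd] := Dd x n.+1%:R^-1; last by exists d.
    by rewrite invr_gt0 ltr0n.
  by exists u => [n|n]; have [] := uP n.
move=> x y u _ _ xu yu; apply: eq_dist => e e0.
have [n nP] := complex_arch (divr_gt0 e0 (ltr0n _ 2)).
rewrite -(subrKA (u n)) (le_trans (ler_normD _ _))// [e]splitr.
by rewrite lerD// ?[`|u n - y|]distrC ltW// (lt_trans _ nP).
Qed.

(** Points of a dense set close to the members of a separated family are
    distinct. *)
Lemma separated_card_le (R : realType) (E : normedModType R[i])
    (g : (nat -> bool) -> E) (d : R[i]) (D : set E) :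
  0 < d -> (forall x y, x <> y -> d <= `|g x - g y|) ->
  dense D -> continuum #<= D.
Proof.
move=> d0 gd /dense_approxP Dd.
have /choice[h hP] : forall x, exists y, D y /\ `|g x - y| < d / 2.
  by move=> x; have [|y ? ?] := Dd (g x) (d / 2); [exact: divr_gt0|exists y].
apply: (continuum_card_le (g := h)) => [x|x y hxy]; first by have [] := hP x.
apply: contrapT => /gd; apply/negP; have [_ hx] := hP x; have [_] := hP y.
rewrite -hxy distrC => hy; rewrite real_leNgt ?ger0_real// ?ltW// negbK.
by rewrite -(subrKA (h x)) [d]splitr (le_lt_trans (ler_normD _ _))// ltrD.
Qed.

Lemma density_continuum (R : realType) (E : normedModType R[i])
    (g : (nat -> bool) -> E) (d : R[i]) (D : set E) :
  0 < d -> (forall x y, x <> y -> d <= `|g x - g y|) ->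
  dense D -> le_continuum D ->
  [set: E] #= continuum /\ density_character_eq E continuum.
Proof.
move=> d0 gd Dd leD.
have dT : dense [set: E].
  by apply/dense_approxP => x e e0; exists x; rewrite // subrr normr0.
have eT : [set: E] #= continuum.
  apply: card_continuum; first exact: le_continuum_dense leD.
  exact: separated_card_le d0 gd dT.
split=> //; split; first by exists setT.
by move=> D'; exact: separated_card_le d0 gd.
Qed.

(** * Hilbert spaces *)

Section Inner.
Context (R : realType) (H : hilbertType R).
Implicit Types (x y z : H) (c : R[i]).

Lemma innerDl x y z : inner (x + y) z = inner x z + inner y z.
Proof. exact: linearDl. Qed.

Lemma innerDr x y z : inner z (x + y) = inner z x + inner z y.
Proof. exact: linearDr. Qed.

Lemma innerZl c x y : inner (c *: x) y = c * inner x y.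
Proof. exact: linearZl_LR. Qed.

Lemma innerZr c x y : inner x (c *: y) = conjC c * inner x y.
Proof. exact: linearZr_LR. Qed.

Lemma inner0l y : inner 0 y = 0.
Proof. exact: linear0l. Qed.

Lemma inner0r y : inner y 0 = 0.
Proof. exact: linear0r. Qed.

Lemma innerBl x y z : inner (x - y) z = inner x z - inner y z.
Proof. exact: linearBl. Qed.

Lemma innerBr x y z : inner z (x - y) = inner z x - inner z y.
Proof. exact: linearBr. Qed.

Lemma innerC x y : inner x y = conjC (inner y x).
Proof. by rewrite {1}hermC expr0 mul1r. Qed.

Lemma inner_eq0C x y : inner x y = 0 -> inner y x = 0.
Proof. by move=> e; rewrite innerC e conjC0. Qed.

Lemma inner_suml I (r : seq I) (P : pred I) (F : I -> H) y :
  inner (\sum_(i <- r | P i) F i) y = \sum_(i <- r | P i) inner (F i) y.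
Proof. exact: linear_sumlz. Qed.

Lemma inner_sumr I (r : seq I) (P : pred I) (F : I -> H) y :
  inner y (\sum_(i <- r | P i) F i) = \sum_(i <- r | P i) inner y (F i).
Proof. exact: linear_sumr. Qed.

Lemma inner_eq0 x : inner x x = 0 -> x = 0.
Proof. by rewrite innerxx => /eqP; rewrite expf_eq0/= normr_eq0 => /eqP. Qed.

Lemma cauchy_schwarz x y : `|inner x y| <= `|x| * `|y|.
Proof.
have [->|y0] := eqVneq y 0; first by rewrite inner0r !normr0 mulr0.
have ny : 0 < `|y| by rewrite normr_gt0.
have ny2 : `|y| ^+ 2 != 0 by rewrite expf_neq0// gt_eqF.
rewrite -(@ler_pXn2r _ 2)// ?nnegrE ?mulr_ge0// exprMn.
set t := inner x y / `|y| ^+ 2.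
have : 0 <= inner (x - t *: y) (x - t *: y) by rewrite innerxx exprn_ge0.
have tE : t * `|y| ^+ 2 = inner x y by rewrite /t divfK.
rewrite innerBl !innerBr !innerZl !innerZr (innerC y x) !innerxx.
have -> : conjC t * `|y| ^+ 2 = conjC (inner x y).
  rewrite -tE [RHS]rmorphM; congr (_ * _); apply/esym/geC0_conj.
  exact: exprn_ge0.
rewrite subrr subr0 subr_ge0.
have -> : conjC t * inner x y = `|inner x y| ^+ 2 / `|y| ^+ 2.
  apply: (mulIf ny2); rewrite divfK// mulrAC normCK mulrC; congr (_ * _).
  rewrite -[in RHS]tE [RHS]rmorphM; congr (_ * _); apply/esym/geC0_conj.
  exact: exprn_ge0.
by rewrite ler_pdivrMr ?exprn_gt0.
Qed.

Lemma inner_dense_eq0 (D : set H) x :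
  dense D -> (forall y, D y -> inner x y = 0) -> x = 0.
Proof.
move=> /dense_approxP Dd xD; apply: eq_dist => e e0; rewrite subr0.
have [->|x0] := eqVneq x 0; first by rewrite normr0 ltW.
have nx : 0 < `|x| by rewrite normr_gt0.
have [y /xD xy xye] := Dd x e e0.
rewrite -(ler_pM2l nx) -expr2 -innerxx -[leLHS]ger0_norm; last first.
  by rewrite innerxx exprn_ge0.
rewrite -[x in inner _ x](subrK y) innerDr xy addr0.
by rewrite (le_trans (cauchy_schwarz _ _))// ler_wpM2l// ltW.
Qed.

Lemma cvg_inner (u : nat -> H) l y :
  (u n @[n --> \oo] --> l) -> inner (u n) y @[n --> \oo] --> inner l y.
Proof.
move=> /cvg_seqP ul; apply/cvgrPdist_le => e e0.
have d0 : 0 < e / (`|y| + 1) by rewrite divr_gt0// ltr_wpDl.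
have [N NP] := ul _ d0; exists N => // n /= /NP lt.
rewrite -innerBl (le_trans (cauchy_schwarz _ _))//.
rewrite (le_trans (ler_wpM2r _ (ltW lt)))// mulrAC ler_pdivrMr ?ltr_wpDl//.
by rewrite ler_pM2l// lerDl.
Qed.

End Inner.

(** * Elementary theory of C*-algebras and their representations *)

Section CStar.
Context (R : realType) (A : cstarAlgType R).
Implicit Types (a b u : A) (c : R[i]).

Lemma starK a : star (star a) = a.
Proof. exact: cstar_invK. Qed.

Lemma starM a b : star (a * b) = star b * star a.
Proof. exact: cstar_invM. Qed.

Lemma starD a b : star (a + b) = star a + star b.
Proof.
by have := @cstar_inv_antilinear R A 1 a b; rewrite scale1r conjC1 scale1r.
Qed.

Lemma star0 : star (0 : A) = 0.
Proof. by apply: (addrI (star 0)); rewrite -starD !addr0. Qed.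

Lemma starZ c a : star (c *: a) = conjC c *: star a.
Proof.
have := @cstar_inv_antilinear R A c a 0; rewrite addr0 => e.
by rewrite [LHS]e -[cstar_inv 0]/(star 0) star0 addr0.
Qed.

Lemma starN a : star (- a) = - star a.
Proof. by apply: (addrI (star a)); rewrite -starD !subrr star0. Qed.

Lemma starB a b : star (a - b) = star a - star b.
Proof. by rewrite starD starN. Qed.

Lemma star1 : star (1 : A) = 1.
Proof. by rewrite -[LHS]mul1r -{1}[1]starK -starM mul1r starK. Qed.

Lemma normM_le a b : `|a * b| <= `|a| * `|b|.
Proof. exact: cstar_normM_le. Qed.

Lemma norm_starM a : `|star a * a| = `|a| ^+ 2.
Proof. exact: cstar_norm_starM. Qed.

Lemma norm_star a : `|star a| = `|a|.
Proof.
have le b : `|b| <= `|star b|.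
  have [->|b0] := eqVneq b 0; first by rewrite star0.
  have nb : 0 < `|b| by rewrite normr_gt0.
  by rewrite -(ler_pM2r nb) -expr2 -norm_starM normM_le.
by apply/le_anti; rewrite le andbT -{2}(starK a) le.
Qed.

Lemma norm_one : `|1 : A| = 1.
Proof.
have n1 : 0 < `|1 : A| by rewrite normr_gt0 oner_neq0.
apply: (mulfI (lt0r_neq0 n1)); rewrite mulr1 -expr2.
by rewrite -norm_starM star1 mulr1.
Qed.

Lemma norm_isometry u : star u * u = 1 -> `|u| = 1.
Proof.
move=> uu; have := norm_starM u; rewrite uu norm_one => /esym/eqP.
by rewrite -[X in _ == X](expr1n _ 2) eqrXn2// => /eqP.
Qed.

Lemma norm_unitary_conj u a : Defs.is_unitary u -> `|u * a * star u| <= `|a|.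
Proof.
move=> [/norm_isometry nu _]; apply: le_trans (normM_le _ _) _.
rewrite norm_star nu mulr1; apply: le_trans (normM_le _ _) _.
by rewrite nu mul1r.
Qed.

Lemma cvg_mul (u v : nat -> A) a b :
  (u n @[n --> \oo] --> a) -> (v n @[n --> \oo] --> b) ->
  u n * v n @[n --> \oo] --> a * b.
Proof.
move=> /cvg_seqP ua /cvg_seqP vb; apply/cvg_seqP => e e0.
pose M := `|a| + `|b| + 1.
have M0 : 0 < M by rewrite ltr_wpDl// addr_ge0.
have d0 : 0 < e / 2 / M by rewrite !divr_gt0.
have [N1 uN] := ua _ d0; have [N2 vN] := vb _ d0; have [N3 v1] := vb _ ltr01.
exists (maxn N1 (maxn N2 N3)) => n; rewrite !geq_max => /and3P[n1 n2 n3].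
have -> : a * b - u n * v n = a * (b - v n) + (a - u n) * v n.
  by rewrite mulrBr mulrBl subrKA.
have vn : `|v n| <= `|b| + 1.
  rewrite -[v n](subrK b) addrC (le_trans (ler_normD _ _))// lerD2l.
  by rewrite distrC ltW// v1.
apply: (@le_lt_trans _ _ (e / 2)); last first.
  by rewrite ltr_pdivrMr// ltr_pMr// ltr1n.
have -> : e / 2 = `|a| * (e / 2 / M) + e / 2 / M * (`|b| + 1).
  by rewrite [_ * (_ / M)]mulrC -mulrDr addrA divfK// lt0r_neq0.
apply: le_trans (ler_normD _ _) (lerD _ _); apply: le_trans (normM_le _ _) _.
  by rewrite ler_wpM2l// ltW// vN.
by rewrite ler_pM// ltW// uN.
Qed.


Lemma cvg_star (u : nat -> A) a :
  (u n @[n --> \oo] --> a) -> star (u n) @[n --> \oo] --> star a.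
Proof.
move=> /cvg_seqP ua; apply/cvg_seqP => e /ua[N NP]; exists N => n Nn.
by rewrite -starB norm_star NP.
Qed.

(** The square root of [1 - a] is [1 - y], where [y] is the fixed point of the
    contraction [y |-> (a + y ^ 2) / 2] of the ball of radius [1 / 2]. *)
Lemma sqrt_one_sub a :
  star a = a -> `|a| <= 2^-1 ->
  exists2 y, star y = y & (1 - y) * (1 - y) = 1 - a.
Proof.
move=> sa na.
pose y := fix y n := if n is m.+1 then 2^-1 *: (a + y m * y m) else 0 : A.
have half0 : 0 <= 2^-1 :> R[i] by rewrite invr_ge0.
have half_le1 : 2^-1 <= 1 :> R[i] by rewrite invf_le1// ler1n.
have half_norm : `|2^-1| = 2^-1 :> R[i] by rewrite ger0_norm.
have sy n : star (y n) = y n.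
  elim: n => [|n IH] /=; first exact: star0.
  by rewrite starZ starD starM IH sa geC0_conj.
have ny n : `|y n| <= 2^-1.
  elim: n => [|n IH] /=; first by rewrite normr0.
  rewrite normrZ half_norm -[leRHS]mulr1 ler_wpM2l// (splitr 1) mul1r.
  rewrite (le_trans (ler_normD _ _))// lerD// (le_trans (normM_le _ _))//.
  by rewrite (le_trans (ler_pM _ _ IH IH))// ler_piMr.
have dy n : `|y n.+1 - y n| <= 2^-1 ^+ n.
  elim: n => [|n IH].
    rewrite /= mulr0 addr0 subr0 normrZ half_norm expr0.
    by rewrite mulr_ile1// (le_trans na).
  have -> : y n.+2 - y n.+1 =
      2^-1 *: (y n.+1 * (y n.+1 - y n) + (y n.+1 - y n) * y n).
    rewrite [y n.+2]/= -/(y n.+1) [in X in _ - X]/= -scalerBr; congr (_ *: _).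
    by rewrite mulrBr mulrBl subrKA opprD addrACA subrr add0r.
  rewrite normrZ half_norm exprS ler_wpM2l// (le_trans (ler_normD _ _))//.
  rewrite [leRHS]splitr lerD//.
    by rewrite (le_trans (normM_le _ _))// mulrC ler_pM.
  by rewrite (le_trans (normM_le _ _))// ler_pM.
have yc : forall e : R[i], 0 < e -> exists N, forall n m,
     (N <= n)%N -> (N <= m)%N -> `|y n - y m| < e.
  move=> e e0.
  have dist n k : `|y (n + k)%N - y n| <= 2 * 2^-1 ^+ n.
    suff : `|y (n + k)%N - y n| <= 2 * 2^-1 ^+ n - 2 * 2^-1 ^+ (n + k)%N.
      by move=> /le_trans; apply; rewrite lerBlDr lerDl mulr_ge0 ?exprn_ge0.
    elim: k => [|k IH]; first by rewrite addn0 !subrr normr0.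
    rewrite -(subrKA (y (n + k)%N)) (le_trans (ler_normD _ _))// addnS.
    rewrite -[leRHS](subrKA (2 * 2^-1 ^+ (n + k)%N)) [leRHS]addrC lerD//.
    rewrite (le_trans (dy _))// exprS mulrA divff ?mul1r ?pnatr_eq0//.
    by rewrite mulr_natl mulr2n addrK.
  have half_pow n : 2^-1 ^+ n <= n.+1%:R^-1 :> R[i].
    rewrite exprVn lef_pV2 ?posrE ?ltr0n ?exprn_gt0// -natrX ler_nat.
    exact: ltn_expl.
  have [N NP] := complex_arch (divr_gt0 e0 (ltr0n _ 4)).
  have small n : (N <= n)%N -> `|y n - y N| < e / 2.
    move=> Nn; rewrite -(subnKC Nn) (le_lt_trans (dist _ _))//.
    rewrite (le_lt_trans (ler_wpM2l _ (half_pow N)))//.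
    rewrite -ltr_pdivlMl// mulrC -mulrA -invfM -natrM.
    exact: NP.
  exists N => n m Nn Nm; rewrite -(subrKA (y N)) [e]splitr.
  by rewrite (le_lt_trans (ler_normD _ _))// ltrD// ?small// distrC small.
have [l yl] := complete_seq yc.
have sl : star l = l.
  apply: (seq_lim_unique (cvg_star yl)).
  by under eq_fun do rewrite sy.
exists l => //.
have ll : l + l = a + l * l.
  have y1 : y n.+1 @[n --> \oo] --> l by rewrite (cvg_shiftS y (nbhs l)).
  have l1 : y n.+1 + y n.+1 @[n --> \oo] --> l + l by exact: cvgD.
  have l2 : y n.+1 + y n.+1 @[n --> \oo] --> a + l * l.
    have -> : (fun n => y n.+1 + y n.+1) = (fun n => a + y n * y n).
      apply/funext => n; rewrite -mulr2n -scaler_nat scalerA.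
      by rewrite divff ?pnatr_eq0// scale1r.
    by apply: cvgD; [exact: cvg_cst|exact: cvg_mul].
  exact: seq_lim_unique l1 l2.
have -> : a = l + l - l * l by rewrite ll addrK.
by rewrite mulrBl mul1r mulrBr mulr1 !opprB addrACA -opprD -addrA.
Qed.
End CStar.

Section LinearFun.
Context (K : nzRingType) (U V : lmodType K) (f : U -> V) (f_lin : linear f).

Lemma lin_add x y : f (x + y) = f x + f y.
Proof. by have := f_lin 1 x y; rewrite !scale1r. Qed.

Lemma lin_zero : f 0 = 0.
Proof. by apply: (addrI (f 0)); rewrite -lin_add !addr0. Qed.

Lemma lin_scale c x : f (c *: x) = c *: f x.
Proof. by have := f_lin c x 0; rewrite lin_zero !addr0. Qed.

Lemma lin_sub x y : f (x - y) = f x - f y.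
Proof. by rewrite lin_add -scaleN1r lin_scale scaleN1r. Qed.

Lemma lin_sum I (r : seq I) (P : pred I) (F : I -> U) :
  f (\sum_(i <- r | P i) F i) = \sum_(i <- r | P i) f (F i).
Proof. exact: (big_morph f lin_add lin_zero). Qed.

End LinearFun.

Section Representation.
Context (R : realType) (A : cstarAlgType R) (H : hilbertType R)
  (pi : A -> H -> H) (pi_rep : is_representation pi).

Lemma rep_lin a : linear (pi a).
Proof. by have [] := rep_bounded pi_rep a. Qed.

Definition repB a b x : pi (a - b) x = pi a x - pi b x :=
  lin_sub (rep_linear pi_rep x) a b.

Definition repB_vec a x y : pi a (x - y) = pi a x - pi a y :=
  lin_sub (rep_lin a) x y.

Lemma rep_adj a x y : inner (pi a x) y = inner x (pi (star a) y).
Proof. exact: (rep_star pi_rep). Qed.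

Lemma rep_adjV a x y : inner x (pi a y) = inner (pi (star a) x) y.
Proof. by rewrite rep_adj starK. Qed.

Lemma inner_rep a b x y : inner (pi a x) (pi b y) = inner (pi (star b * a) x) y.
Proof. by rewrite rep_adjV -(rep_mul pi_rep). Qed.

(** If [b] is the multiple of [star a * a] of norm [1 / 2], then [1 - b] is the
    square of a self-adjoint element, so that [pi b <= 1]; this scaling is where
    the constant [2] comes from. *)
Lemma rep_norm_le a x : `|pi a x| <= 2 * `|a| * `|x|.
Proof.
have [->|a0] := eqVneq a 0.
  by rewrite (lin_zero (rep_linear pi_rep x)) !normr0 mulr0 mul0r.
have na : 0 < `|a| by rewrite normr_gt0.
have M0 : 0 < 2 * `|a| ^+ 2 by rewrite mulr_gt0// exprn_gt0.
pose c := (2 * `|a| ^+ 2)^-1; have c0 : 0 < c by rewrite invr_gt0.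
have cr : star (c *: (star a * a)) = c *: (star a * a).
  by rewrite starZ starM starK geC0_conj// ltW.
have [|y sy yE] := sqrt_one_sub cr.
  rewrite normrZ norm_starM gtr0_norm// /c invfM -mulrA mulVf ?mulr1//.
  by rewrite expf_neq0// lt0r_neq0.
have : 0 <= inner (pi (1 - y) x) (pi (1 - y) x) by rewrite innerxx exprn_ge0.
rewrite inner_rep starB star1 sy yE repB (rep_one pi_rep) innerBl.
rewrite (lin_scale (rep_linear pi_rep x)) innerZl -inner_rep !innerxx.
rewrite subr_ge0 mulrC ler_pdivrMr// => le.
rewrite -(@ler_pXn2r _ 2)// ?nnegrE ?mulr_ge0// (le_trans le)//.
rewrite mulrC !exprMn ler_wpM2r ?exprn_ge0// ler_wpM2r ?exprn_ge0//.
by rewrite expr2 ler_peMr// ler1n.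
Qed.

End Representation.

Lemma GNS_norm (R : realType) (A : cstarAlgType R) (phi : A -> R[i])
    (H : hilbertType R) (pi : A -> H -> H) (xi : H) :
  is_GNS_triple phi pi xi -> forall a, `|pi a xi| ^+ 2 = phi (star a * a).
Proof.
by move=> [pi_rep _ phiE] a; rewrite phiE -innerxx (inner_rep pi_rep).
Qed.

Lemma GNS_eq0 (R : realType) (A : cstarAlgType R) (phi : A -> R[i])
    (H : hilbertType R) (pi : A -> H -> H) (xi : H) :
  is_GNS_triple phi pi xi -> forall a, phi (star a * a) = 0 -> pi a xi = 0.
Proof.
move=> gns a; rewrite -(GNS_norm gns) => /eqP.
by rewrite expf_eq0/= normr_eq0 => /eqP.
Qed.

(** * One-site elements of the CAR algebra and bit flips *)

Section TensorStep.
Context (K : comNzRingType).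

Lemma castmx_sq_mul (p q : nat) (e : p = q) (a b : 'M[K]_p) :
  castmx (e, e) a *m castmx (e, e) b = castmx (e, e) (a *m b).
Proof. by case: q / e; rewrite !castmx_id. Qed.

Lemma castmx_sq_scalar (p q : nat) (e : p = q) (c : K) :
  castmx (e, e) c%:M = c%:M.
Proof. by case: q / e; rewrite castmx_id. Qed.

Lemma castmx_sq_trace (p q : nat) (e : p = q) (a : 'M[K]_p) :
  \tr (castmx (e, e) a) = \tr a.
Proof. by case: q / e; rewrite castmx_id. Qed.

Lemma castmx_sq_delta (p q : nat) (e : p = q) (i : 'I_p) :
  castmx (e, e) (delta_mx i i : 'M[K]_p) =
  delta_mx (cast_ord e i) (cast_ord e i).
Proof. by case: q / e; rewrite castmx_id cast_ord_id. Qed.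

Lemma tensor_step_mul n (a a' : 'M[K]_(2 ^ n)) (b b' : 'M[K]_2) :
  tensor_step a b *m tensor_step a' b' = tensor_step (a *m a') (b *m b').
Proof. by rewrite /tensor_step castmx_sq_mul tensmx_mul. Qed.

Lemma tensor_step1 n : tensor_step 1%:M 1%:M = 1%:M :> 'M[K]_(2 ^ n.+1).
Proof.
rewrite /tensor_step -[RHS](castmx_sq_scalar (esym (expnSr 2 n))).
congr castmx; apply/matrixP => r s.
case: (mxtens_indexP r) => r1 r2; case: (mxtens_indexP s) => s1 s2.
by rewrite tensmxE !mxE (can_eq (@mxtens_indexK _ _)) xpair_eqE -natrM mulnb.
Qed.

Lemma tensor_step_trace n (a : 'M[K]_(2 ^ n)) (b : 'M[K]_2) :
  \tr (tensor_step a b) = \tr a * \tr b.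
Proof.
rewrite castmx_sq_trace /mxtrace mulr_suml.
under [RHS]eq_bigr do rewrite mulr_sumr.
rewrite pair_big /= (reindex (@mxtens_index _ _)) /=; last first.
  exists (@mxtens_unindex _ _) => ? _; first exact: mxtens_indexK.
  exact: mxtens_unindexK.
by apply: eq_bigr => -[i j] _; rewrite tensmxE.
Qed.

Lemma tensor_step_delta n (i : 'I_(2 ^ n)) (j : 'I_2) :
  exists k, tensor_step (delta_mx i i) (delta_mx j j) = delta_mx k k
    :> 'M[K]_(2 ^ n.+1).
Proof.
exists (cast_ord (esym (expnSr 2 n)) (mxtens_index (i, j))).
rewrite -castmx_sq_delta; congr castmx; apply/matrixP => r s.
case: (mxtens_indexP r) => r1 r2; case: (mxtens_indexP s) => s1 s2.
rewrite tensmxE !mxE !(can_eq (@mxtens_indexK _ _)) !xpair_eqE.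
by rewrite -natrM mulnb andbACA.
Qed.

Lemma tensor_prod_delta (s : nat -> 'I_2) n :
  exists k, tensor_prod (fun i => delta_mx (s i) (s i)) n = delta_mx k k
    :> 'M[K]_(2 ^ n).
Proof.
elim: n => [|n [k IH]] /=; last by rewrite IH; exact: tensor_step_delta.
by exists ord0; apply/matrixP => i j; rewrite !ord1 !mxE.
Qed.

Lemma tensor_prod1 (a : nat -> 'M[K]_2) n :
  (forall k, (k < n)%N -> a k = 1%:M) -> tensor_prod a n = 1%:M.
Proof.
elim: n => //= n IH a1; rewrite IH => [|k kn]; last by rewrite a1// ltnS ltnW.
by rewrite a1// tensor_step1.
Qed.

End TensorStep.

Lemma tensor_step_adj (R : realType) n (a : 'M[R[i]]_(2 ^ n)) (b : 'M[R[i]]_2) :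
  map_mx conjC (tensor_step a b)^T =
  tensor_step (map_mx conjC a^T) (map_mx conjC b^T).
Proof. by rewrite /tensor_step trmx_cast /= map_castmx trmx_tens map_mxT. Qed.

Section Site.
Context (R : realType) (C : CARalgebra R).
Implicit Types (n m k : nat) (b : 'M[R[i]]_2) (z : nat -> bool).

Lemma emb_le m n (a : 'M[R[i]]_(2 ^ m)) :
  (m <= n)%N -> exists a' : 'M[R[i]]_(2 ^ n), emb C m a = emb C n a'.
Proof.
elim: n => [|n IH]; first by rewrite leqn0 => /eqP m0; subst m; exists a.
rewrite leq_eqVlt => /predU1P[mn|/IH[a' ->]]; first by subst m; exists a.
by exists (tensor_step a' 1%:M); rewrite emb_step.
Qed.

Definition site k b : C := emb C k.+1 (tensor_step 1%:M b).

Lemma siteM k b b' : site k b * site k b' = site k (b *m b').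
Proof. by rewrite /site -emb_mul tensor_step_mul mulmx1. Qed.

Lemma site1 k : site k 1%:M = 1.
Proof. by rewrite /site tensor_step1 emb_one. Qed.

Lemma star_site k b : star (site k b) = site k (map_mx conjC b^T).
Proof. by rewrite /site -emb_star tensor_step_adj trmx1 map_mx1. Qed.

Lemma emb_site n (a : 'M[R[i]]_(2 ^ n)) b :
  emb C n a * site n b = emb C n.+1 (tensor_step a b).
Proof. by rewrite -emb_step /site -emb_mul tensor_step_mul mulmx1 mul1mx. Qed.

Lemma site_comm n k (a : 'M[R[i]]_(2 ^ n)) b :
  (n <= k)%N -> site k b * emb C n a = emb C n a * site k b.
Proof.
move=> /(@emb_le _ _ a)[a' ->]; rewrite emb_site -(emb_step C a') /site.
by rewrite -emb_mul tensor_step_mul mulmx1 mul1mx.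
Qed.

Lemma site_tensor_prod k b :
  site k b =
  emb C k.+1 (tensor_prod (fun i => if i == k then b else 1%:M) k.+1).
Proof.
by rewrite /= eqxx tensor_prod1// => i ik; rewrite ltn_eqF.
Qed.

(** Each tensor factor is seen as one bit: booleans label the two diagonal
    matrix units, and the Pauli matrix exchanging them flips the bit. *)
Definition bitproj (x : bool) : 'M[R[i]]_2 :=
  if x then delta_mx ord_max ord_max else delta_mx ord0 ord0.

Definition bitflip (x : bool) : 'M[R[i]]_2 :=
  \matrix_(i, j) (if x then i != j else i == j)%:R.

Lemma bitflipM x : bitflip x *m bitflip x = 1%:M.
Proof.
apply/matrixP => i j; rewrite !mxE !big_ord_recl big_ord0 !mxE.
by case: x; case/orP: (orbN (i == ord0)) => [/eqP->|];
  case: i => [[|[|i]]] //= ?; case: j => [[|[|j]]] //= ?;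
  rewrite ?(mul0r, mulr0, mul1r, addr0, add0r).
Qed.

Lemma bitflip_adj x : map_mx conjC (bitflip x)^T = bitflip x.
Proof.
by apply/matrixP => i j; rewrite !mxE conjC_nat eq_sym.
Qed.

Lemma bitflip_proj x y :
  bitflip x *m bitproj y *m bitflip x = bitproj (y (+) x).
Proof.
apply/matrixP => i j; rewrite !mxE !big_ord_recl big_ord0 !mxE.
rewrite !big_ord_recl !big_ord0 !mxE.
by case: x; case: y; case: i => [[|[|i]]] //= ?; case: j => [[|[|j]]] //= ?;
  rewrite !mxE /= ?(mul0r, mulr0, mul1r, addr0, add0r).
Qed.

Lemma bitproj_adj x : map_mx conjC (bitproj x)^T = bitproj x.
Proof. by apply/matrixP => i j; case: x; rewrite !mxE conjC_nat andbC. Qed.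

Lemma bitprojM x : bitproj x *m bitproj x = bitproj x.
Proof. by case: x; rewrite mul_delta_mx. Qed.

End Site.

(** * The bit-flip automorphisms of the CAR algebra *)

Section Flip.
Context (R : realType) (C : CARalgebra R).
Implicit Types (n m k : nat) (z : nat -> bool) (a b : C).

Lemma emb_approx a (e : R[i]) :
  0 < e -> exists n, exists x : 'M[R[i]]_(2 ^ n), `|a - emb C n x| < e.
Proof.
move=> e0; have /dense_approxP Cd := @emb_dense R C.
by have [_ [n _ [x _ <-]] ax] := Cd a e e0; exists n, x.
Qed.

Fixpoint flips z n : C :=
  if n is m.+1 then flips z m * site C m (bitflip R (z m)) else 1.

Lemma flips_emb z n : exists x, flips z n = emb C n x.
Proof.
elim: n => [|n [x IH]] /=; first by exists 1%:M; rewrite emb_one.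
by exists (tensor_step x (bitflip R (z n))); rewrite IH emb_site.
Qed.

Lemma flips_star z n : star (flips z n) = flips z n.
Proof.
elim: n => [|n IH] /=; first exact: star1.
rewrite starM star_site bitflip_adj IH; have [x ->] := flips_emb z n.
exact: site_comm.
Qed.

Lemma flips_invol z n : flips z n * flips z n = 1.
Proof.
elim: n => [|n IH] /=; first by rewrite mulr1.
have [x xE] := flips_emb z n; rewrite mulrA -[_ * _ * flips z n]mulrA.
rewrite {2}xE site_comm// -xE mulrA IH mul1r siteM bitflipM.
exact: site1.
Qed.

Lemma flips_unitary z n : Defs.is_unitary (flips z n).
Proof. by split; rewrite flips_star flips_invol. Qed.

Definition flip_at z n a := flips z n * a * flips z n.

Lemma flip_at_norm z n a : `|flip_at z n a| <= `|a|.
Proof.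
by rewrite /flip_at -{2}flips_star norm_unitary_conj//; exact: flips_unitary.
Qed.

Lemma flip_at_emb z m (x : 'M[R[i]]_(2 ^ m)) n :
  (m <= n)%N -> flip_at z n (emb C m x) = flip_at z m (emb C m x).
Proof.
elim: n => [|n IH]; first by rewrite leqn0 => /eqP m0; subst m.
rewrite leq_eqVlt => /predU1P[mn|mn]; first by subst m.
rewrite -{}IH// /flip_at /=; set s := site C n _; set f := flips z n.
have sx : s * emb C m x = emb C m x * s by exact: site_comm.
have fs : f * s = s * f.
  by rewrite /f; have [y ->] := flips_emb z n; rewrite [s * _]site_comm.
have ss : s * s = 1 by rewrite siteM bitflipM site1.
by rewrite -(mulrA f) sx fs !mulrA -(mulrA _ s s) ss mulr1.
Qed.

Lemma flip_atB z n a b : flip_at z n (a - b) = flip_at z n a - flip_at z n b.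
Proof. by rewrite /flip_at mulrBr mulrBl. Qed.

Lemma flip_cvg_ex z a : exists l : C, flip_at z n a @[n --> \oo] --> l.
Proof.
apply: complete_seq => e e0.
have [m [x ax]] := emb_approx a (divr_gt0 e0 (ltr0n _ 2)).
exists m => n k mn mk; rewrite -(subrKA (flip_at z m (emb C m x))) [e]splitr.
rewrite (le_lt_trans (ler_normD _ _))// ltrD//.
  by rewrite -(flip_at_emb z x mn) -flip_atB (le_lt_trans (flip_at_norm _ _ _)).
rewrite -(flip_at_emb z x mk) -flip_atB (le_lt_trans (flip_at_norm _ _ _))//.
by rewrite distrC.
Qed.

(** The infinite tensor product of the conjugations by [bitflip (z n)]. It
    exists as a pointwise limit because the conjugations by the finite products
    [flips] are contractive and become constant on each finite stage. *)
Definition flip z a : C := sval (cid (flip_cvg_ex z a)).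

Lemma flip_cvg z a : flip_at z n a @[n --> \oo] --> flip z a.
Proof. by rewrite /flip; case: cid. Qed.

Lemma flip_eq z a b : (flip_at z n a @[n --> \oo] --> b) -> flip z a = b.
Proof. by move=> ab; exact: seq_lim_unique (@flip_cvg z a) ab. Qed.

Lemma flip_emb z m (x : 'M[R[i]]_(2 ^ m)) :
  flip z (emb C m x) = flip_at z m (emb C m x).
Proof.
apply: flip_eq; apply/cvg_seqP => e e0; exists m => n mn.
by rewrite flip_at_emb// subrr normr0.
Qed.

Lemma flip_linear z : linear (flip z).
Proof.
move=> c a b; apply: flip_eq.
have -> : (fun n => flip_at z n (c *: a + b)) =
    (fun n => c *: flip_at z n a + flip_at z n b).
  by apply/funext => n; rewrite /flip_at mulrDr mulrDl -scalerAr -scalerAl.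
by apply: cvgD; [apply: cvgZr; exact: flip_cvg|exact: flip_cvg].
Qed.

Lemma flipM z a b : flip z (a * b) = flip z a * flip z b.
Proof.
apply: flip_eq.
have -> : (fun n => flip_at z n (a * b)) =
    (fun n => flip_at z n a * flip_at z n b).
  apply/funext => n; rewrite /flip_at !mulrA.
  by rewrite -(mulrA _ (flips z n) (flips z n)) flips_invol mulr1.
by apply: cvg_mul; exact: flip_cvg.
Qed.

Lemma flip1 z : flip z 1 = 1.
Proof.
by rewrite -(emb_one C 0) flip_emb /flip_at /= mul1r mulr1.
Qed.

Lemma flip_star z a : flip z (star a) = star (flip z a).
Proof.
apply: flip_eq.
have -> : (fun n => flip_at z n (star a)) = (fun n => star (flip_at z n a)).
  by apply/funext => n; rewrite /flip_at !starM !flips_star mulrA.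
by apply: cvg_star; exact: flip_cvg.
Qed.

Lemma flip_norm z a : `|flip z a| <= `|a|.
Proof.
rewrite -[flip z a]subr0 distrC; apply: le_lim (@flip_cvg z a) _.
by exists 0%N => n _; rewrite sub0r normrN flip_at_norm.
Qed.

Lemma flipK z a : flip z (flip z a) = a.
Proof.
apply: eq_dist => e e0.
have [m [x ax]] := emb_approx a (divr_gt0 e0 (ltr0n _ 2)).
have -> : flip z (flip z a) - a =
    flip z (flip z (a - emb C m x)) + (emb C m x - a).
  rewrite !(lin_sub (flip_linear z)).
  suff -> : flip z (flip z (emb C m x)) = emb C m x by rewrite subrKA.
  have [y yE] := flips_emb z m.
  rewrite (flip_emb z x) /flip_at {1 2}yE -!emb_mul flip_emb !emb_mul -yE.
  by rewrite /flip_at !mulrA flips_invol mul1r -mulrA flips_invol mulr1.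
rewrite (le_trans (ler_normD _ _))// [e]splitr lerD//; last first.
  by rewrite distrC ltW.
by rewrite (le_trans (flip_norm _ _))// (le_trans (flip_norm _ _))// ltW.
Qed.

Lemma flip_bitproj z k y :
  flip z (site C k (bitproj R y)) = site C k (bitproj R (y (+) z k)).
Proof.
rewrite {1}/site flip_emb -/(site C k _) /flip_at /=.
set g := site C k (bitflip R (z k)); set s := site C k _; set f := flips z k.
have comm t : site C k t * f = f * site C k t.
  by rewrite /f; have [x ->] := flips_emb z k; rewrite site_comm.
rewrite -(mulrA f) siteM -comm mulrA -(mulrA _ f f) flips_invol mulr1.
by rewrite siteM bitflip_proj.
Qed.

End Flip.

(** * Uniqueness of the GNS representation *)

Section GNSUnique.
Context (R : realType) (A : cstarAlgType R) (phi : A -> R[i]).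

Lemma GNS_inner (H : hilbertType R) (pi : A -> H -> H) (xi : H) :
  is_GNS_triple phi pi xi ->
  forall a b, inner (pi a xi) (pi b xi) = phi (star b * a).
Proof. by move=> [pi_rep _ phiE] a b; rewrite phiE (inner_rep pi_rep). Qed.

Lemma GNS_approx (H : hilbertType R) (pi : A -> H -> H) (xi : H) :
  is_GNS_triple phi pi xi ->
  forall x (e : R[i]), 0 < e -> exists a, `|x - pi a xi| < e.
Proof.
move=> [_ /dense_approxP Dd _] x e e0.
by have [_ [a _ <-] xa] := Dd x e e0; exists a.
Qed.

Lemma GNS_ext (H : hilbertType R) (pi : A -> H -> H) (xi : H) :
  is_GNS_triple phi pi xi ->
  forall x y, (forall b, inner x (pi b xi) = inner y (pi b xi)) -> x = y.
Proof.
move=> [_ Dd _] x y e; apply/eqP; rewrite -subr_eq0; apply/eqP.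
by apply: (inner_dense_eq0 Dd) => _ [b _ <-]; rewrite innerBl e subrr.
Qed.

(** A sequence of cyclic vectors converges in one GNS space if and only if it
    does in the other, the inner products of such vectors being prescribed by
    the state. *)
Lemma GNS_transfer (H H' : hilbertType R) (pi : A -> H -> H)
    (pi' : A -> H' -> H') (xi : H) (xi' : H') :
  is_GNS_triple phi pi xi -> is_GNS_triple phi pi' xi' ->
  forall x : H, exists (y : H') (u : nat -> A),
    (pi (u n) xi @[n --> \oo] --> x) /\ (pi' (u n) xi' @[n --> \oo] --> y).
Proof.
move=> gns gns' x.
have /choice[u uP] : forall n, exists a, `|x - pi a xi| < n.+1%:R^-1.
  by move=> n; apply: (GNS_approx gns); rewrite invr_gt0 ltr0n.
have ux : pi (u n) xi @[n --> \oo] --> x.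
  apply/cvg_seqP => e /complex_arch[N Ne]; exists N => n Nn.
  exact: lt_trans (lt_le_trans (uP n) (invn_le_complex R Nn)) Ne.
suff [y uy] : exists y : H', pi' (u n) xi' @[n --> \oo] --> y by exists y, u.
apply: complete_seq => e e0.
have [N NP] := (cvg_seqP _ _).1 ux (e / 2) (divr_gt0 e0 (ltr0n _ 2)).
exists N => n m Nn Nm.
have -> : `|pi' (u n) xi' - pi' (u m) xi'| = `|pi (u n) xi - pi (u m) xi|.
  have [rep _ _] := gns; have [rep' _ _] := gns'.
  rewrite -(repB rep) -(repB rep'); apply/eqP.
  by rewrite -(@eqrXn2 _ 2)// (GNS_norm gns) (GNS_norm gns').
rewrite -(subrKA x) [e]splitr (le_lt_trans (ler_normD _ _))// ltrD ?NP//.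
by rewrite distrC NP.
Qed.

(** The image of [x] is characterized by its inner products with the cyclic
    vectors, which makes linearity and the intertwining property formal. *)
Lemma GNS_unique (H H' : hilbertType R) (pi : A -> H -> H)
    (pi' : A -> H' -> H') (xi : H) (xi' : H') :
  is_GNS_triple phi pi xi -> is_GNS_triple phi pi' xi' ->
  unitarily_equivalent pi pi'.
Proof.
move=> gns gns'; have [rep _ _] := gns; have [rep' _ _] := gns'.
have transfer (x : H) (y : H') (u : nat -> A) :
    (pi (u n) xi @[n --> \oo] --> x) -> (pi' (u n) xi' @[n --> \oo] --> y) ->
    forall b, inner x (pi b xi) = inner y (pi' b xi').
  move=> ux uy b.
  apply: (@seq_lim_unique _ _ (fun n => inner (pi (u n) xi) (pi b xi))).
    exact: cvg_inner.
  have -> : (fun n => inner (pi (u n) xi) (pi b xi)) =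
            (fun n => inner (pi' (u n) xi') (pi' b xi')).
    by apply/funext => n; rewrite (GNS_inner gns) (GNS_inner gns').
  exact: cvg_inner.
have /choice[U UP] := GNS_transfer gns gns'.
have UE x b : inner (U x) (pi' b xi') = inner x (pi b xi).
  by have [u [ux uy]] := UP x; rewrite (transfer _ _ _ ux uy).
exists U; last first.
  move=> a x; apply: (GNS_ext gns') => b.
  rewrite UE (rep_adj rep) (rep_adj rep') -(rep_mul rep) -(rep_mul rep').
  by rewrite UE.
split.
- move=> c x y; apply: (GNS_ext gns') => b.
  by rewrite innerDl innerZl !UE -innerZl -innerDl.
- move=> x y; have [u [ux uy]] := UP x.
  apply: (@seq_lim_unique _ _ (fun n => inner (pi' (u n) xi') (U y))).
    exact: cvg_inner.
  have -> : (fun n => inner (pi' (u n) xi') (U y)) =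
            (fun n => inner (pi (u n) xi) y).
    by apply/funext => n; rewrite innerC UE -innerC.
  exact: cvg_inner.
- move=> y; have [x [u [uy ux]]] := GNS_transfer gns' gns y.
  exists x; apply: (GNS_ext gns') => b.
  by rewrite UE (transfer _ _ _ ux uy).
Qed.

End GNSUnique.

(** * Irreducible representations of the CAR algebra *)

Section Irreducible.
Context (R : realType).

Lemma closed_approx (E : normedModType R[i]) (W : set E) x :
  closed W -> (forall e : R[i], 0 < e -> exists2 w, W w & `|x - w| < e) -> W x.
Proof.
move=> Wc Wx; apply: Wc => B /nbhs_ballP[e /= e0 eB].
have [w Ww xw] := Wx e e0; exists w; split => //.
by apply: eB; rewrite -ball_normE.
Qed.

Lemma norm_proj (A : cstarAlgType R) (p : A) :
  star p = p -> p * p = p -> `|p| <= 1.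
Proof.
move=> sp pp; have := norm_starM p; rewrite sp pp.
have [->|p0] := eqVneq p 0; first by rewrite normr0.
have np : `|p| != 0 by rewrite normr_eq0.
by rewrite expr2 -{1}[`|p|]mulr1 => /(mulfI np) <-.
Qed.

Lemma irreducible_comp (A : cstarAlgType R) (H : hilbertType R)
    (pi : A -> H -> H) (f : A -> A) :
  linear f -> (forall a b, f (a * b) = f a * f b) -> f 1 = 1 ->
  (forall a, f (star a) = star (f a)) -> (forall a, exists b, f b = a) ->
  irreducible_rep pi -> irreducible_rep (fun a => pi (f a)).
Proof.
move=> f_lin fM f1 f_star f_surj [rep nz irr]; split => //.
  split=> [a|x c a b|x|a b x|a x y].
  - exact: rep_bounded.
  - by rewrite f_lin (rep_linear rep).
  - by rewrite f1 (rep_one rep).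
  - by rewrite fM (rep_mul rep).
  - by rewrite f_star (rep_star rep).
move=> W Wsub Wc Winv; apply: irr => // a x Wx.
by have [b <-] := f_surj a; exact: Winv.
Qed.

Context (C : CARalgebra R).

Lemma GNS_approx_emb (phi : C -> R[i]) (H : hilbertType R) (pi : C -> H -> H)
    (xi : H) :
  is_GNS_triple phi pi xi -> forall x (e : R[i]), 0 < e ->
  exists n, exists a : 'M[R[i]]_(2 ^ n), `|x - pi (emb C n a) xi| < e.
Proof.
move=> gns x e e0; have [rep _ _] := gns.
have e2 : 0 < e / 2 by exact: divr_gt0.
have [a xa] := GNS_approx gns x e2.
have M0 : 0 < 2 * (`|xi| + 1) by rewrite mulr_gt0// ltr_wpDl.
have [n [m am]] := emb_approx a (divr_gt0 e2 M0).
exists n, m; rewrite -(subrKA (pi a xi)) [e]splitr.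
rewrite (le_lt_trans (ler_normD _ _))// ltrD// -(repB rep).
rewrite (le_lt_trans (rep_norm_le rep _ _))//.
rewrite (@le_lt_trans _ _ (`|a - emb C n m| * (2 * (`|xi| + 1))))//.
  by rewrite [2 * `|_|]mulrC -mulrA ler_wpM2l// ler_wpM2l// lerDl.
by rewrite -ltr_pdivlMr.
Qed.

Section ZeroState.
Context (phi : C -> R[i]) (phi0 : is_zero_product_state phi)
  (H : hilbertType R) (pi : C -> H -> H) (xi : H)
  (gns : is_GNS_triple phi pi xi).

Let rep : is_representation pi. Proof. by case: gns. Qed.

Lemma zero_state_unit : inner xi xi = 1.
Proof.
have [_ _ phiE] := gns; have [[_ _ phi1] _] := phi0.
by rewrite -phi1 phiE (rep_one rep).
Qed.

Lemma proj_fix p : star p = p -> p * p = p -> phi p = 1 -> pi p xi = xi.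
Proof.
move=> sp pp phip; apply/eqP; rewrite eq_sym -subr_eq0; apply/eqP/inner_eq0.
rewrite -{1 3}(rep_one rep xi) -!(repB rep) (inner_rep rep).
rewrite starB star1 sp mulrBl mul1r mulrBr mulr1 pp subrr subr0.
have [_ _ phiE] := gns.
by rewrite (repB rep) innerBl (rep_one rep) zero_state_unit -phiE phip subrr.
Qed.

Lemma site_fix k : pi (site C k (bitproj R false)) xi = xi.
Proof.
apply: proj_fix; first by rewrite star_site bitproj_adj.
  by rewrite siteM bitprojM.
have [_ phiE] := phi0; rewrite site_tensor_prod phiE big1// => i _.
by case: ifP => _; rewrite !mxE.
Qed.

Lemma site_kill k : pi (site C k (bitproj R true)) xi = 0.
Proof.
apply: (GNS_eq0 gns); rewrite star_site bitproj_adj siteM bitprojM.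
have [_ phiE] := phi0; rewrite site_tensor_prod phiE.
by rewrite (bigD1 ord_max)//= eqxx mxE mul0r.
Qed.

Lemma q_delta n : exists k, q_ C n = emb C n (delta_mx k k).
Proof.
have [k kE] := tensor_prod_delta R[i] (fun=> ord0) n.
by exists k; rewrite /q_ kE.
Qed.

Lemma q_star n : star (q_ C n) = q_ C n.
Proof.
have [k ->] := q_delta n; rewrite -emb_star; congr (emb _ _ _).
by rewrite trmx_delta map_delta_mx.
Qed.

Lemma q_idem n : q_ C n * q_ C n = q_ C n.
Proof. by have [k ->] := q_delta n; rewrite -emb_mul mul_delta_mx. Qed.

Lemma zero_state_q n : phi (q_ C n) = 1.
Proof.
by have [_ phiE] := phi0; rewrite phiE big1// => i _; rewrite mxE eqxx.
Qed.

Lemma q_fix n : pi (q_ C n) xi = xi.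
Proof. exact: proj_fix (q_star n) (q_idem n) (zero_state_q n). Qed.

(** The projections [q_n] are minimal in the finite stages, so that
    [q_n a q_n = phi a q_n]; hence [pi (q_n)] converges strongly to the
    projection onto the line of [xi]. *)
Lemma q_compress n (a : 'M[R[i]]_(2 ^ n)) :
  pi (q_ C n) (pi (emb C n a) xi) = inner (pi (emb C n a) xi) xi *: xi.
Proof.
have [k kE] := q_delta n.
have compress : pi (q_ C n) (pi (emb C n a) xi) = a k k *: xi.
  rewrite -{1}(q_fix n) -!(rep_mul rep) {1 2}kE -!emb_mul.
  have -> : delta_mx k k *m a *m delta_mx k k = a k k *: delta_mx k k.
    apply/matrixP => i j; rewrite mxE (bigD1 k)//= big1 ?addr0; last first.
      by move=> l /negbTE lk; rewrite [delta_mx k k l j]mxE lk mulr0.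
    rewrite mxE (bigD1 k)//= big1 ?addr0; last first.
      by move=> l /negbTE lk; rewrite [delta_mx k k i l]mxE lk andbF mul0r.
    by rewrite !mxE eqxx andbT mulrAC mulrC -natrM mulnb.
  by rewrite linearZ /= -kE (lin_scale (rep_linear rep xi)) q_fix.
rewrite compress; congr (_ *: _).
rewrite -{2}(q_fix n) (rep_adjV rep) q_star compress innerZl.
by rewrite zero_state_unit mulr1.
Qed.

(** By [q_compress], a closed invariant subspace that is not orthogonal to [xi]
    contains [xi]. One that is orthogonal to [xi] is orthogonal to every
    [pi a xi], by invariance under [pi (star a)]. *)
Lemma zero_state_irreducible : irreducible_rep pi.
Proof.
have xi1 := zero_state_unit.
have nxi : `|xi| = 1.
  by apply/eqP; rewrite -(@eqrXn2 _ 2)// -innerxx xi1 expr1n.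
split; first exact: rep.
  exists xi; apply/eqP => xi0; move: xi1; rewrite xi0 inner0l => /esym/eqP.
  by rewrite oner_eq0.
move=> W [W0 Wlin] Wc Winv.
have Wz c x : W x -> W (c *: x).
  by move=> Wx; rewrite -[_ *: _]addr0; exact: Wlin.
have [[x Wx xxi]|nW] := pselect (exists2 x, W x & inner x xi <> 0);
  [right|left].
  suff Wxi : W xi.
    apply/seteqP; split=> // y _; apply: closed_approx Wc _ => e e0.
    by have [a ya] := GNS_approx gns y e0; exists (pi a xi) => //; exact: Winv.
  suff Wc' : W (inner x xi *: xi).
    rewrite -[xi](scalerK (_ : inner x xi != 0)); last exact/eqP.
    exact: Wz.
  apply: closed_approx Wc _ => e e0.
  have e3 : 0 < e / 3 by exact: divr_gt0.
  have [n [a xa]] := GNS_approx_emb gns x e3.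
  exists (pi (q_ C n) x); first exact: Winv.
  set y := pi (emb C n a) xi in xa.
  have -> : inner x xi *: xi - pi (q_ C n) x =
      inner (x - y) xi *: xi - pi (q_ C n) (x - y).
    by rewrite innerBl (repB_vec rep) q_compress scalerBl opprB addrA subrK.
  apply: le_lt_trans (ler_normB _ _) _.
  have -> : e = e / 3 + 2 * (e / 3).
    by rewrite -[X in X + _]mul1r -mulrDl -(natrD _ 1 2) mulrC divfK ?pnatr_eq0.
  rewrite ltrD//.
    rewrite normrZ nxi mulr1 (le_lt_trans (cauchy_schwarz _ _))//.
    by rewrite nxi mulr1.
  rewrite (le_lt_trans (rep_norm_le rep _ _))// -mulrA ltr_pM2l//.
  by rewrite (le_lt_trans _ xa)// ler_piMl// norm_proj// ?q_star ?q_idem.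
apply/seteqP; split=> [x Wx|x ->//]; apply: (GNS_ext gns) => b.
rewrite inner0l (rep_adjV rep).
by apply: contrapT => nz; apply: nW; exists (pi (star b) x) => //; exact: Winv.
Qed.

(** A composite of the two unitaries would send [xi] to a unit vector fixed by
    the projections onto the label [true] at infinitely many sites. Such a
    vector is orthogonal to every [pi a xi] with [a] in a finite stage, since at
    a far site the projection commutes with [a] and kills [xi]. *)
Lemma flip_inequivalent (K : hilbertType R) (sigma : C -> K -> K)
    (y z : nat -> bool) :
  (forall m, exists2 k, (m <= k)%N & y k <> z k) ->
  unitarily_equivalent sigma (fun a => pi (flip y a)) ->
  unitarily_equivalent sigma (fun a => pi (flip z a)) -> False.
Proof.
move=> yz [U [U_lin U_iso U_surj] UE] [V [V_lin V_iso V_surj] VE].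
have [eta etaE] := U_surj xi.
have U_inj u v : U u = U v -> u = v.
  move=> uv; apply/eqP; rewrite -subr_eq0; apply/eqP/inner_eq0.
  by rewrite -U_iso (lin_sub U_lin) uv subrr inner0l.
have fix_eta k : sigma (flip y (site C k (bitproj R false))) eta = eta.
  by apply: U_inj; rewrite UE flipK etaE site_fix.
have fix_V k : y k <> z k -> pi (site C k (bitproj R true)) (V eta) = V eta.
  move=> yzk; rewrite -[in RHS](fix_eta k) VE !flip_bitproj.
  by congr (pi (site _ _ (bitproj _ _)) _); case: (y k) (z k) yzk => [] [].
suff V0 : V eta = 0.
  have := zero_state_unit; rewrite -etaE U_iso -V_iso V0 inner0l.
  by move=> /esym/eqP; rewrite oner_eq0.
apply: (@inner_dense_eq0 _ _ [set x | exists n, exists a : 'M[R[i]]_(2 ^ n),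
    x = pi (emb C n a) xi]).
  apply/dense_approxP => x e e0; have [n [a xa]] := GNS_approx_emb gns x e0.
  by exists (pi (emb C n a) xi) => //; exists n, a.
move=> _ [n [a ->]]; have [k nk /fix_V <-] := yz n.
rewrite (rep_adj rep) star_site bitproj_adj -(rep_mul rep) site_comm//.
by rewrite (rep_mul rep) site_kill (lin_zero (rep_lin rep _)) inner0r.
Qed.

End ZeroState.
End Irreducible.

(** * The index set has the cardinality of the continuum *)

Lemma asymptotically_inner_norm (R : realType) (A : cstarAlgType R)
    (f : A -> A) a : asymptotically_inner f -> `|f a| <= `|a|.
Proof.
move=> [u [_ uU _ /(_ a) ucvg]]; apply/ler_addgt0Pr => e e0.
move/cvgrPdist_le : ucvg => /(_ e e0) near_u.
have [t [/= le t0]] :=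
  filter_ex (filterI near_u (nbhs_pinfty_ge (num_real (0 : R)))).
rewrite -(subrK (u t * a * star (u t)) (f a)) addrC.
rewrite (le_trans (ler_normD _ _))// lerD// norm_unitary_conj//; exact: uU.
Qed.

Lemma exists_large_pickle (n m : nat) : exists2 j, (m <= j)%N &
  odflt (0, 0)%N (unpickle j) = (n, (odflt (0, 0)%N (unpickle j)).2).
Proof.
have [|j mj] := @injective_gtn (fun j => pickle (n, j)) _ m.
  by move=> i j /(pcan_inj pickleK) [].
by exists (pickle (n, j)); rewrite ?pickleK// ltnW.
Qed.

Section IndexSet.
Context (R : realType) (C : CARalgebra R) (D : pureStateData C).
Implicit Types (i k : psI D).

Lemma ps_rep i : is_representation (@ps_pi _ _ D i).
Proof. by have [] := ps_GNS i. Qed.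

Lemma ps_alpha_surj i a : exists b, ps_alpha i b = a.
Proof. by have [[g _ gK] _] := ps_alpha_aut i; exists (g a). Qed.

(** This reduces every representation of the transversal to the distinguished
    product state; in particular it is irreducible. *)
Lemma ps_alpha_GNS i :
  is_GNS_triple (ps_phi (psr D)) (fun a => @ps_pi _ _ D i (ps_alpha i a))
    (ps_xi i).
Proof.
have [rep Dd phiE] := ps_GNS i; have [_ f_star] := ps_alpha_aut i.
split.
- split=> [a|x c a b|x|a b x|a x y].
  + exact: rep_bounded.
  + by rewrite linearP (rep_linear rep).
  + by rewrite rmorph1 (rep_one rep).
  + by rewrite rmorphM (rep_mul rep).
  + by rewrite f_star (rep_star rep).
- suff <- : range (fun a => ps_pi a (ps_xi i)) =
      range (fun a => ps_pi (ps_alpha i a) (ps_xi i)) by [].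
  apply/seteqP; split=> _ [a _ <-]; last by exists (ps_alpha i a).
  by have [b <-] := ps_alpha_surj i a; exists b.
- by move=> a; rewrite -phiE ps_alpha_phi.
Qed.

Lemma ps_irreducible i : irreducible_rep (@ps_pi _ _ D i).
Proof.
have [_ nz irr] := zero_state_irreducible (ps_phi_r D) (ps_alpha_GNS i).
split; [exact: ps_rep|exact: nz|move=> W Wsub Wc Winv].
by apply: irr => // a x; exact: Winv.
Qed.

Lemma unitarily_equivalent_refl (A : cstarAlgType R) (H : hilbertType R)
  (pi : A -> H -> H) : unitarily_equivalent pi pi.
Proof. by exists idfun => //; split=> // y; exists y. Qed.

Lemma ps_phi_inj i k : ps_phi i =1 ps_phi k -> i = k.
Proof.
move=> ik; have [l [_ l_uniq]] := ps_transversal D (ps_irreducible k).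
have gns_i : is_GNS_triple (ps_phi k) (@ps_pi _ _ D i) (ps_xi i).
  by have [? ? phiE] := ps_GNS i; split => // a; rewrite -ik.
have li := l_uniq i (GNS_unique gns_i (ps_GNS k)).
by rewrite -li; apply: l_uniq; exact: unitarily_equivalent_refl.
Qed.

Lemma ps_alpha_inj i k : ps_alpha i =1 ps_alpha k -> i = k.
Proof.
move=> ik; apply: ps_phi_inj => a.
by have [b <-] := ps_alpha_surj i a; rewrite [in RHS]ik !ps_alpha_phi.
Qed.

(** The automorphisms are contractive, being pointwise limits of inner ones, so
    they are determined by the matrix units of the finite stages. *)
Lemma ps_alpha_ext i k :
  (forall n (r s : 'I_(2 ^ n)), ps_alpha i (emb C n (delta_mx r s)) =
                                ps_alpha k (emb C n (delta_mx r s))) -> i = k.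
Proof.
move=> ik; apply: ps_alpha_inj => a.
have ik_emb n x : ps_alpha i (emb C n x) = ps_alpha k (emb C n x).
  rewrite (matrix_sum_delta x) !linear_sum; apply: eq_bigr => r _.
  by rewrite !linear_sum; apply: eq_bigr => s _; rewrite !linearZ /= ik.
apply: eq_dist => e e0.
have [n [x ax]] := emb_approx a (divr_gt0 e0 (ltr0n _ 2)).
rewrite -(subrKA (ps_alpha i (emb C n x))) [in X in _ + (X - _)]ik_emb.
rewrite -!linearB.
rewrite [e]splitr (le_trans (ler_normD _ _))// lerD//;
  rewrite (le_trans (asymptotically_inner_norm _ (ps_alpha_inner _)))//.
  exact: ltW.
by rewrite distrC ltW.
Qed.

Lemma le_continuum_matrix n : le_continuum [set: 'M[R[i]]_(2 ^ n)].
Proof.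
have leC := le_continuum_complex R.
apply: (le_continuum_rel (r := fun (x : 'M[R[i]]_(2 ^ n)) (g : nat -> R[i]) =>
  forall r s, g (pickle (r, s)) = x r s) (le_continuum_seq leC)).
  move=> x _; exists (fun j => oapp (fun p => x p.1 p.2) 0 (unpickle j)) => //.
  by move=> r s; rewrite pickleK.
by move=> x y g _ _ gx gy; apply/matrixP => r s; rewrite -gx gy.
Qed.

Lemma le_continuum_CAR : le_continuum [set: C].
Proof.
apply: (le_continuum_dense (@emb_dense R C)).
apply: le_continuum_bigcup => [|n _]; first exact: le_continuum_countType.
apply: le_continuum_image; exact: le_continuum_matrix.
Qed.

Lemma le_continuum_index : le_continuum [set: psI D].
Proof.
have leC := le_continuum_seq (le_continuum_seq le_continuum_CAR).
apply: (le_continuum_rel (r := fun (i : psI D) (g : nat -> nat -> C) =>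
  forall n (r s : 'I_(2 ^ n)),
    g n (pickle (r, s)) = ps_alpha i (emb C n (delta_mx r s))) leC).
  move=> i _; exists (fun n j => oapp (fun p : 'I_(2 ^ n) * 'I_(2 ^ n) =>
    ps_alpha i (emb C n (delta_mx p.1 p.2))) 0 (unpickle j)) => //.
  by move=> n r s; rewrite pickleK.
by move=> i k g _ _ gi gk; apply: ps_alpha_ext => n r s; rewrite -gi gk.
Qed.

(** Repeating each bit infinitely often makes distinct bit sequences differ
    infinitely often, so that the corresponding flips of the distinguished
    representation are inequivalent. *)
Lemma continuum_index : exists g : (nat -> bool) -> psI D, injective g.
Proof.
pose spread (x : nat -> bool) j := x (odflt (0, 0)%N (unpickle j)).1.
have irr x :
    irreducible_rep (fun a => @ps_pi _ _ D (psr D) (flip (spread x) a)).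
  apply: irreducible_comp (ps_irreducible (psr D)).
  - exact: flip_linear.
  - exact: flipM.
  - exact: flip1.
  - exact: flip_star.
  - by move=> a; exists (flip (spread x) a); rewrite flipK.
have /choice[g gP] x := ps_transversal D (irr x).
exists g => x y gxy; apply: contrapT => xy.
have [n xyn] : exists n, x n <> y n.
  apply: contrapT => /forallNP h; apply: xy; apply/funext => n.
  exact: contrapT (h n).
apply: (flip_inequivalent (ps_phi_r D) (ps_GNS (psr D))
  (y := spread x) (z := spread y) (sigma := @ps_pi _ _ D (g x))).
- move=> m; have [j mj jE] := exists_large_pickle n m; exists j => //.
  by rewrite /spread jE.
- by have [] := gP x.
- by rewrite gxy; have [] := gP y.
Qed.

End IndexSet.

(** * Spans and orthonormal families *)

Section Span.
Context (K : numFieldType) (V : lmodType K).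
Implicit Types E W : set V.

Lemma span_sub E : E `<=` linear_span E.
Proof. by move=> x Ex W [_ EW]; exact: EW. Qed.

Lemma span_subspace E : is_subspace (linear_span E).
Proof.
split=> [W [[]//]|c x y Ex Ey W [Wsub EW]].
by have [_ Wlin] := Wsub; apply: Wlin; [exact: Ex|exact: Ey].
Qed.

Lemma span_min E W : is_subspace W -> E `<=` W -> linear_span E `<=` W.
Proof. by move=> Wsub EW x; apply. Qed.

Lemma subspaceZ W c x : is_subspace W -> W x -> W (c *: x).
Proof. by move=> [W0 Wl] Wx; rewrite -[_ *: _]addr0; exact: Wl. Qed.

Lemma subspace_sum W I (r : seq I) (P : pred I) (F : I -> V) :
  is_subspace W -> (forall i, P i -> W (F i)) -> W (\sum_(i <- r | P i) F i).
Proof.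
move=> [W0 Wl] FW; elim/big_rec: _ => // i x Pi Wx.
by rewrite -[F i]scale1r; apply: Wl => //; exact: FW.
Qed.

Lemma span_family n (e : 'I_n -> V) x :
  linear_span (range e) x -> exists c : 'I_n -> K, x = \sum_i c i *: e i.
Proof.
move: x; apply: span_min.
  split=> [|c _ _ [f ->] [g ->]].
    by exists (fun=> 0); rewrite big1// => i _; rewrite scale0r.
  exists (fun i => c * f i + g i); rewrite scaler_sumr -big_split /=.
  by apply: eq_bigr => i _; rewrite scalerDl scalerA.
move=> _ [i _ <-]; exists (fun j => (j == i)%:R).
rewrite (bigD1 i)//= eqxx scale1r big1 ?addr0// => j /negbTE ->.
by rewrite scale0r.
Qed.

End Span.

Lemma le_continuum_span (R : realType) (V : lmodType R[i]) (E : set V) :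
  le_continuum E -> le_continuum (linear_span E).
Proof.
move=> leE; have leE0 : le_continuum (E `|` [set 0]).
  pose F (b : bool) := if b then E else [set 0].
  apply: (@le_continuum_sub _ _ (\bigcup_b F b)).
    by move=> x [Ex|x0]; [exists true|exists false].
  apply: le_continuum_bigcup => [|[] _ //]; first exact: le_continuum_bool.
  by exists (fun _ _ => true) => x y /= -> ->.
have [Y [EY leY Yop]] := le_continuum_closure
  (fun (c : R[i]) (x y : V) => c *: x + y) (le_continuum_complex R) leE0.
apply: le_continuum_sub leY; apply: span_min => [|x Ex]; last first.
  by apply: EY; left.
by split=> [|c x y Yx Yy]; [apply: EY; right|exact: Yop].
Qed.

Section Orthonormal.
Context (R : realType) (H : hilbertType R).
Implicit Types (x y : H) (s : seq H).

Definition orthonormal_seq s :=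
  uniq s /\ forall x y, x \in s -> y \in s -> inner x y = (x == y)%:R.

Definition residual s x := x - \sum_(b <- s) inner x b *: b.

Lemma residual_orth s x b :
  orthonormal_seq s -> b \in s -> inner (residual s x) b = 0.
Proof.
move=> [s_uniq s_on] bs; rewrite innerBl inner_suml (big_rem b)//=.
rewrite innerZl (s_on b b)// eqxx mulr1 big_seq big1 ?addr0 ?subrr// => y.
rewrite mem_rem_uniq// inE => /andP[/negbTE yb ys].
by rewrite innerZl (s_on y b)// yb mulr0.
Qed.

Lemma bessel s x :
  orthonormal_seq s -> \sum_(b <- s) `|inner x b| ^+ 2 <= `|x| ^+ 2.
Proof.
move=> s_on; rewrite -subr_ge0.
have <- : inner (residual s x) (residual s x) =
    `|x| ^+ 2 - \sum_(b <- s) `|inner x b| ^+ 2.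
  rewrite {2}/residual innerBr inner_sumr big_seq.
  rewrite big1 ?subr0 => [|b bs]; last by rewrite innerZr residual_orth ?mulr0.
  rewrite innerBl innerxx inner_suml; congr (_ - _); apply: eq_bigr => b _.
  by rewrite innerZl (innerC b x) normCK.
by rewrite innerxx exprn_ge0.
Qed.

Lemma orthonormal_basis_neq0 (B : set H) x :
  orthonormal_basis B -> inner x x = 1 -> exists2 b, B b & inner x b <> 0.
Proof.
move=> [_ Bd] x1; apply: contrapT => nB.
suff x0 : x = 0 by move: x1; rewrite x0 inner0l => /esym/eqP; rewrite oner_eq0.
apply: (inner_dense_eq0 Bd); apply: span_min => [|b Bb].
  split=> [|c y z xy xz]; first exact: inner0r.
  by rewrite innerDr innerZr xy xz mulr0 addr0.
by apply: contrapT => xb; apply: nB; exists b.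
Qed.

(** By Bessel's inequality a vector has only finitely many coefficients of
    modulus larger than [1 / (n + 1)] along an orthonormal family. *)
Lemma countable_coefficients (T : pointedType) (z : T -> H) (b : H) :
  (forall t, inner (z t) (z t) = 1) ->
  (forall t u, t <> u -> inner (z t) (z u) = 0) ->
  countable [set t | inner b (z t) <> 0].
Proof.
move=> z1 z0.
pose F n := [set t | n.+1%:R^-1 < `|inner b (z t)|].
apply: (@sub_countable _ _ _ (\bigcup_n F n)).
  apply: subset_card_le => x /= /eqP nz.
  have [|n nP] := @complex_arch R `|inner b (z x)|; first by rewrite normr_gt0.
  by exists n.
apply: bigcup_countable => // n _; apply: finite_set_countable.
apply: contrapT => /infiniteP/pcard_leP/unsquash f.
have [N NP] : exists N : nat, n.+1%:R ^+ 2 * `|b| ^+ 2 < N%:R.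
  have M0 : 0 < n.+1%:R ^+ 2 * `|b| ^+ 2 + 1.
    by rewrite ltr_wpDl// mulr_ge0// exprn_ge0.
  have [N NP] : exists N, N.+1%:R^-1 < (n.+1%:R ^+ 2 * `|b| ^+ 2 + 1)^-1.
    by apply: complex_arch; rewrite invr_gt0.
  exists N.+1; move: NP; rewrite ltf_pV2 ?posrE// => NP.
  by apply: lt_trans NP; rewrite ltrDl.
have f_inj : injective f by move=> i j; apply: inj; rewrite inE.
have z_inj : injective z.
  move=> x y zxy; apply: contrapT => /z0; rewrite zxy z1 => /eqP.
  by rewrite oner_eq0.
pose s := [seq z (f i) | i <- iota 0 N].
have s_on : orthonormal_seq s.
  split; first by rewrite map_inj_uniq ?iota_uniq// => i j /z_inj/f_inj.
  move=> _ _ /mapP[i _ ->] /mapP[j _ ->].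
  by case: eqP => [->|ne]; [exact: z1|rewrite z0// => e; apply: ne; rewrite e].
have := bessel b s_on; rewrite big_map => le.
have : \sum_(i <- iota 0 N) n.+1%:R^-1 ^+ 2 <= `|b| ^+ 2.
  apply: le_trans le; apply: ler_sum => i _; rewrite ler_pXn2r ?nnegrE//.
  by apply: ltW; have : F n (f i) by exact: funS.
rewrite big_const_seq count_predT size_iota iter_addr_0.
rewrite -[_ *+ N]mulr_natl exprVn.
rewrite ler_pdivrMr ?exprn_gt0 ?ltr0n// mulrC => /(lt_le_trans NP).
by rewrite ltxx.
Qed.

(** Each [z t] has a nonzero coefficient along some basis vector, and each basis
    vector is used by only countably many [t]. *)
Lemma orthonormal_basis_continuum (B : set H) (z : (nat -> bool) -> H) :
  (forall t, inner (z t) (z t) = 1) ->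
  (forall t u, t <> u -> inner (z t) (z u) = 0) ->
  orthonormal_basis B -> continuum #<= B.
Proof.
move=> z1 z0 Bon.
have /choice[b bP] t : exists b, B b /\ inner b (z t) <> 0.
  have [b Bb zb] := orthonormal_basis_neq0 Bon (z1 t).
  by exists b; split => // /inner_eq0C.
have /choice[c cP] (d : H) : exists c : (nat -> bool) -> nat,
    {in [set y | inner d (z y) <> 0] &, injective c}.
  exact/countable_injP/countable_coefficients.
apply: (continuum_koenig (g := b) (k := fun t => c (b t) t)).
  by move=> t; have [] := bP t.
move=> t u btu; rewrite -btu => /cP; apply; rewrite inE /=.
  by have [] := bP t.
by rewrite btu; have [] := bP u.
Qed.

End Orthonormal.

(** * Orthonormal bases of separable Hilbert spaces *)

Section GramSchmidt.
Context (R : realType) (H : hilbertType R).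
Implicit Types (x y : H) (s : seq H).

Lemma orthonormal_seq_total s :
  orthonormal_seq s -> dense (linear_span [set` s]) ->
  linear_span [set` s] = setT.
Proof.
move=> s_on sd; apply/seteqP; split=> // x _.
suff /eqP : residual s x = 0.
  rewrite subr_eq0 => /eqP ->; rewrite big_seq.
  apply: subspace_sum; first exact: span_subspace.
  by move=> b bs; apply: (subspaceZ _ (span_subspace _)); exact: span_sub.
apply: (inner_dense_eq0 sd); apply: span_min => [|b /= bs].
  split=> [|c y z xy xz]; first exact: inner0r.
  by rewrite innerDr innerZr xy xz mulr0 addr0.
exact: residual_orth.
Qed.

Variable v : nat -> H.

Fixpoint gram_schmidt n : seq H :=
  if n is m.+1 then
    let s := gram_schmidt m in
    let r := residual s (v m) in
    if r == 0 then s else `|r|^-1 *: r :: s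
  else [::].

Lemma gram_schmidt_orthonormal n : orthonormal_seq (gram_schmidt n).
Proof.
elim: n => [|n IH] /=; first by split.
case: eqP => // /eqP r0; set r := residual _ _ in r0 *.
have nr : `|r| != 0 by rewrite normr_eq0.
pose e := `|r|^-1 *: r.
have e1 : inner e e = 1.
  rewrite innerZl innerZr geC0_conj ?invr_ge0// innerxx expr2.
  by rewrite mulKf// mulVf.
have e0 b : b \in gram_schmidt n -> inner e b = 0.
  by move=> bs; rewrite innerZl residual_orth// mulr0.
have es : e \notin gram_schmidt n.
  by apply/negP => /e0 e'; move/eqP: e1; rewrite e' eq_sym oner_eq0.
have [s_uniq s_on] := IH; split=> [|x y]; first by rewrite cons_uniq es.
have ne b : b \in gram_schmidt n -> e == b = false.
  by move=> bs; apply/negbTE/eqP => eb; move: es; rewrite eb bs.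
rewrite !in_cons => /predU1P[->|xs] /predU1P[->|ys]; rewrite -/e.
- by rewrite e1 eqxx.
- by rewrite e0// ne.
- by rewrite (inner_eq0C (e0 _ xs)) eq_sym ne.
- exact: s_on.
Qed.

Lemma gram_schmidt_le n m :
  (n <= m)%N -> {subset gram_schmidt n <= gram_schmidt m}.
Proof.
elim: m => [|m IH]; first by rewrite leqn0 => /eqP ->.
rewrite leq_eqVlt => /predU1P[->//|/IH sub] x /sub xm /=.
by case: eqP => // _; rewrite in_cons xm orbT.
Qed.

Lemma gram_schmidt_span n : linear_span [set` gram_schmidt n.+1] (v n).
Proof.
have res :
    linear_span [set` gram_schmidt n.+1] (residual (gram_schmidt n) (v n)).
  rewrite /=; case: eqP => [->|/eqP r0].
    by have [] := span_subspace [set` gram_schmidt n].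
  set r := residual _ _ in r0 *.
  have nr : `|r| != 0 by rewrite normr_eq0.
  rewrite -[X in linear_span _ X](scalerKV nr).
  apply: (subspaceZ _ (span_subspace _)); apply: span_sub => /=.
  by rewrite in_cons eqxx.
rewrite -[v n](subrK (\sum_(b <- gram_schmidt n) inner (v n) b *: b)).
have [_ lin] := span_subspace [set` gram_schmidt n.+1].
rewrite -[X in X + _]scale1r; apply: lin => //; rewrite big_seq.
apply: subspace_sum; first exact: span_subspace.
move=> b bs; apply: (subspaceZ _ (span_subspace _)); apply: span_sub.
exact: (gram_schmidt_le (leqnSn n)).
Qed.

End GramSchmidt.

Lemma separable_orthonormal_basis (R : realType) (H : hilbertType R) :
  separable_space H -> infinite_dimensional H ->
  exists2 B : set H, orthonormal_basis B & B #= [set: nat].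
Proof.
move=> [D Dc Dd] Hinf.
have [v vD] : exists v : nat -> H, D `<=` range v.
  have /countable_injP[f f_inj] := Dc.
  exists (fun n => xget 0 [set x | D x /\ f x = n]) => x Dx.
  exists (f x) => //; case: xgetP => [y _ [Dy fy]|/(_ x)[]//].
  by apply: f_inj fy; rewrite inE.
pose B := \bigcup_n [set` gram_schmidt v n].
have Bon : orthonormal_basis B.
  split=> [x y [n _ xn] [m _ ym]|].
    have [_] := gram_schmidt_orthonormal v (maxn n m); apply.
      exact: gram_schmidt_le (leq_maxl n m) _ xn.
    exact: gram_schmidt_le (leq_maxr n m) _ ym.
  move=> U U0 oU; have [x [Ux Dx]] := Dd U U0 oU; exists x; split=> //.
  have [n _ <-] := vD x Dx.
  suff sub : linear_span [set` gram_schmidt v n.+1] `<=` linear_span B.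
    by apply: sub; exact: gram_schmidt_span.
  by apply: span_min (span_subspace B) _ => y ys; apply: span_sub; exists n.+1.
exists B => //; apply: eq_card_nat.
  by apply: bigcup_countable => // n _; apply/finite_set_countable/finite_seq.
move=> /finite_seqP[s Bs]; apply: Hinf.
have sE : [set` undup s] = B.
  by rewrite Bs; apply/seteqP; split=> x; rewrite /= mem_undup.
have s_on : orthonormal_seq (undup s).
  split=> [|x y xs ys]; first exact: undup_uniq.
  by have [on _] := Bon; apply: on; rewrite -sE.
exists (size (undup s)), (tnth (in_tuple (undup s))).
rewrite -(orthonormal_seq_total s_on) ?sE//; last by have [] := Bon.
congr linear_span; rewrite -sE; apply/seteqP; split=> x /=.
  by move=> [k _ <-]; exact: mem_tnth.
by move=> xs; have /tnthP[k ->] : x \in in_tuple (undup s) by []; exists k.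
Qed.

(** Among [n + 1] vectors in the span of [n] vectors there is a linear relation,
    which orthonormality excludes. *)
Lemma infinite_orthonormal (R : realType) (H : hilbertType R) (z : nat -> H) :
  (forall k l, inner (z k) (z l) = (k == l)%:R) -> infinite_dimensional H.
Proof.
move=> z_on [n [e eT]].
have /choice[c cP] k : exists c : 'I_n -> R[i], z k = \sum_i c i *: e i.
  by apply: span_family; rewrite eT.
pose M := \matrix_(k < n.+1, i < n) c k i.
have [u u0 uM] : exists2 u : 'rV_n.+1, u != 0 & u *m M = 0.
  have : kermx M != 0.
    rewrite -mxrank_eq0 mxrank_ker subn_eq0 -ltnNge.
    exact: leq_ltn_trans (rank_leq_col _) _.
  case/rowV0Pn => u /sub_kermxP uM u0; by exists u.
have uz : \sum_k u 0 k *: z (val k) = 0.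
  transitivity (\sum_i (u *m M) 0 i *: e i).
    under eq_bigr do rewrite cP scaler_sumr.
    rewrite exchange_big; apply: eq_bigr => i _ /=.
    rewrite mxE scaler_suml; apply: eq_bigr => k _.
    by rewrite scalerA mxE.
  by rewrite uM big1// => i _; rewrite mxE scale0r.
case/eqP: u0; apply/rowP => l; rewrite mxE.
have := congr1 (fun x => inner x (z (val l))) uz.
rewrite inner0l inner_suml (bigD1 l)//= innerZl z_on eqxx mulr1 big1 ?addr0//.
by move=> k kl; rewrite innerZl z_on (inj_eq val_inj) (negbTE kl) mulr0.
Qed.

(** * Separability of the tracial representation *)

Lemma rational_approx (R : realType) (c e : R[i]) :
  0 < e -> exists p : rat * rat,
  `|c - (ratr p.1 +i* ratr p.2)| < e.
Proof.
move=> e0; have er : e = (complex.Re e)%:C.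
  by case: e e0 => a b; rewrite ltcE /= => /andP[/eqP ->].
have r0 : 0 < complex.Re e / 2.
  by move: e0; rewrite {1}er ltcR => /divr_gt0; apply.
have approx (x : R) : exists q : rat, `|x - ratr q| < complex.Re e / 2.
  have [|q] := @rat_in_itvoo _ (x - complex.Re e / 2) (x + complex.Re e / 2).
    by rewrite ltrD2l gtrN.
  rewrite in_itv/= => /andP[q1 q2]; exists q.
  by rewrite distrC ltr_distl q1.
have [p pP] := approx (complex.Re c); have [q qP] := approx (complex.Im c).
exists (p, q); case: c pP qP => a b /= pP qP.
have -> : (a +i* b) - (ratr p +i* ratr q) =
    (a - ratr p)%:C + 'i * (b - ratr q)%:C.
  by rewrite [RHS]addrC; simpc.
have norm_real (r : R) : `|r%:C| = `|r|%:C :> R[i].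
  by rewrite normc_def /= expr0n addr0 sqrtr_sqr.
rewrite (le_lt_trans (ler_normD _ _))// normrM normCi mul1r !norm_real er.
by rewrite -rmorphD ltcR [ltRHS]splitr ltrD.
Qed.

Lemma CAR_separable (R : realType) (C : CARalgebra R) :
  exists2 X : set C, countable X & dense X.
Proof.
pose val (p : rat * rat) : R[i] := ratr p.1 +i* ratr p.2.
exists (\bigcup_n
  range (fun a : 'M[rat * rat]_(2 ^ n) => emb C n (map_mx val a))).
  apply: bigcup_countable => // n _.
  exact: card_le_trans (card_image_le _ _) (countableP _).
apply/dense_approxP => x e e0.
have [n [a xa]] := emb_approx x (divr_gt0 e0 (ltr0n _ 2)).
pose M := \sum_(p : 'I_(2 ^ n) * 'I_(2 ^ n)) `|emb C n (delta_mx p.1 p.2)|.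
have M0 : 0 <= M by exact: sumr_ge0.
have d0 : 0 < e / 2 / (M + 1) by rewrite !divr_gt0// ltr_wpDl.
have /choice[b bP] (p : 'I_(2 ^ n) * 'I_(2 ^ n)) :=
  rational_approx (a p.1 p.2) d0.
exists (emb C n (map_mx val (\matrix_(r, s) b (r, s)))).
  by exists n => //; exists (\matrix_(r, s) b (r, s)).
rewrite -(subrKA (emb C n a)) [e]splitr (le_lt_trans (ler_normD _ _))//.
rewrite ltr_leD//.
rewrite -linearB [X in emb C n X]matrix_sum_delta pair_big linear_sum /=.
rewrite (le_trans (ler_norm_sum _ _ _))//.
rewrite (@le_trans _ _ (e / 2 / (M + 1) * M))//.
  rewrite mulr_sumr; apply: ler_sum => -[r s] _ /=.
  rewrite linearZ /= normrZ ler_wpM2r//.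
  by rewrite !mxE; exact: ltW (bP (r, s)).
rewrite -[leRHS](divfK (_ : M + 1 != 0)); last by rewrite lt0r_neq0// ltr_wpDl.
by rewrite ler_pM2l// lerDl.
Qed.

Lemma GNS_separable (R : realType) (C : CARalgebra R) (phi : C -> R[i])
    (H : hilbertType R) (pi : C -> H -> H) (xi : H) :
  is_GNS_triple phi pi xi -> separable_space H.
Proof.
move=> gns; have [rep _ _] := gns.
have [X Xc /dense_approxP Xd] := CAR_separable C.
exists ((fun a => pi a xi) @` X).
  exact: card_le_trans (card_image_le _ _) Xc.
apply/dense_approxP => x e e0; have e2 : 0 < e / 2 by exact: divr_gt0.
have [a xa] := GNS_approx gns x e2.
have M0 : 0 < 2 * (`|xi| + 1) by rewrite mulr_gt0// ltr_wpDl.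
have [b Xb ab] := Xd a _ (divr_gt0 e2 M0).
exists (pi b xi); first by exists b.
rewrite -(subrKA (pi a xi)) [e]splitr (le_lt_trans (ler_normD _ _))// ltrD//.
rewrite -(repB rep) (le_lt_trans (rep_norm_le rep _ _))//.
rewrite (@le_lt_trans _ _ (`|a - b| * (2 * (`|xi| + 1))))//.
  by rewrite [2 * `|_|]mulrC -mulrA ler_wpM2l// ler_wpM2l// lerDl.
by rewrite -ltr_pdivlMr.
Qed.

(** The reflections [diag(1, -1)] at distinct sites form an infinite orthonormal
    family, because traces multiply under tensor products and this reflection
    has trace zero. *)
Lemma trace_infinite_dimensional (R : realType) (C : CARalgebra R)
    (tau : C -> R[i]) (H : hilbertType R) (pi : C -> H -> H) (xi : H) :
  is_CAR_trace tau -> is_GNS_triple tau pi xi -> infinite_dimensional H.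
Proof.
move=> [[tau_st tau_tr] tauE] gns.
pose s : 'M[R[i]]_2 := \matrix_(i, j) ((-1) ^+ i *+ (i == j)).
have s_adj : map_mx conjC s^T = s.
  apply/matrixP => i j; rewrite !mxE eq_sym; case: eqP => [->|_].
    by rewrite !mulr1n rmorphXn rmorphN1.
  by rewrite !mulr0n conjC0.
have ss : s *m s = 1%:M.
  apply/matrixP => i j; rewrite !mxE !big_ord_recl big_ord0 !mxE.
  case: i => [[|[|i]]] //= ?; case: j => [[|[|j]]] //= ?;
  by rewrite ?mulr1n ?mulr0n ?mul0r ?mulr0 ?addr0 ?add0r ?mulr1 ?mulrNN ?mulr1.
have str : \tr s = 0.
  by rewrite /mxtrace !big_ord_recl big_ord0 !mxE /= !mulr1n addr0 subrr.
apply: (infinite_orthonormal (z := fun k => pi (site C k s) xi)) => k l.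
rewrite (GNS_inner gns) star_site s_adj.
wlog kl : k l / (k <= l)%N.
  move=> th; have [kl|/ltnW lk] := leqP k l; first exact: th.
  by rewrite eq_sym tau_tr; exact: th.
move: kl; rewrite leq_eqVlt => /predU1P[->|kl].
  by rewrite siteM ss site1 eqxx; case: tau_st.
rewrite (ltn_eqF kl) {2}/site.
have [a ->] := emb_le C (tensor_step 1%:M s) kl.
by rewrite site_comm// emb_site tauE tensor_step_trace str mulr0 mulr0.
Qed.

(** * Cardinality of a generated C*-algebra *)

Lemma dense_seqP (R : realType) (E : normedModType R[i]) (Y : set E) (a : E) :
  (exists2 u : nat -> E, (forall n, Y (u n)) & u n @[n --> \oo] --> a) <->
  (forall e : R[i], 0 < e -> exists2 y, Y y & `|a - y| < e).
Proof.
split=> [[u uY /cvg_seqP ua] e /ua[N NP]|aY].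
  by exists (u N) => //; exact: NP.
have /choice[u uP] n : exists y, Y y /\ `|a - y| < n.+1%:R^-1.
  by have [|y ? ?] := aY n.+1%:R^-1; [rewrite invr_gt0|exists y].
exists u => [n|]; first by have [] := uP n.
apply/cvg_seqP => e /complex_arch[N Ne]; exists N => n Nn.
have [_ un] := uP n.
exact: lt_trans (lt_le_trans un (invn_le_complex R Nn)) Ne.
Qed.

Section Generated.
Context (R : realType) (A : cstarAlgType R) (H : hilbertType R)
  (iota : A -> H -> H) (G : set (H -> H))
  (A_def : is_concrete_cstar iota (cstar_generated G)).

Let rep : is_representation iota. Proof. by case: A_def. Qed.

Lemma concrete_norm_le a (M : R[i]) :
  0 <= M -> (forall x, `|iota a x| <= M * `|x|) -> `|a| <= M.
Proof. by have [_ /(_ a)[_ _ aM] _] := A_def; exact: aM. Qed.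

Lemma concrete_vec_le a x : `|iota a x| <= `|a| * `|x|.
Proof. by have [_ /(_ a)[_ aM _] _] := A_def; exact: aM. Qed.

Lemma concrete_inj a b : iota a = iota b -> a = b.
Proof.
move=> ab; apply: eq_dist => e e0; apply: le_trans (ltW e0).
apply: concrete_norm_le => // x.
by rewrite (repB rep) ab subrr normr0 mul0r.
Qed.

Lemma generated_concrete T : G T -> exists a, iota a = T.
Proof.
move=> GT; have [_ _ AG] := A_def.
suff : cstar_generated G T by rewrite -AG => -[a _ <-]; exists a.
by move=> W [_ GW]; exact: GW.
Qed.

(** The star-algebra generated by [G] inside [A] is dense, because its closure
    is mapped onto a norm-closed star-algebra of operators containing [G]. *)
Lemma le_continuum_generated : le_continuum G -> le_continuum [set: A].
Proof.
move=> leG.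
have leX : le_continuum [set a | G (iota a)].
  apply: (le_continuum_inj (f := iota) leG) => // a b _ _.
  exact: concrete_inj.
pose op (p : R[i] * option bool) (x y : A) := match p.2 with
  | None => p.1 *: x + y | Some false => x * y | Some true => star x end.
have leP : le_continuum [set: R[i] * option bool].
  rewrite -setXTT; apply: le_continuum_setX; first exact: le_continuum_complex.
  exact: le_continuum_countType.
have [Y [XY leY Yop]] := le_continuum_closure op leP leX.
apply: le_continuum_dense leY; apply/dense_approxP => a; apply/dense_seqP.
have [_ _ AG] := A_def.
pose W := [set a : A | exists2 u : nat -> A, (forall n, Y (u n)) &
  u n @[n --> \oo] --> a].
suff sub : cstar_generated G `<=` iota @` W.
  have : cstar_generated G (iota a) by rewrite -AG; exists a.
  by move=> /sub[b Wb /concrete_inj <-].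
move=> T; apply; split; last first.
  move=> _ /[dup] /generated_concrete[b <-] Gb; exists b => //.
  by exists (fun=> b) => [_|]; [exact: XY|exact: cvg_cst].
split.
- by move=> _ [b _ <-]; exact: rep_bounded.
- move=> c _ _ [x [u uY ux] <-] [y [v vY vy] <-]; exists (c *: x + y).
    exists (fun n => c *: u n + v n) => [n|].
      exact: (Yop (c, None)).
    by apply: cvgD => //; exact: cvgZr.
  by apply/funext => z; rewrite (rep_linear rep).
- move=> _ _ [x [u uY ux] <-] [y [v vY vy] <-]; exists (x * y).
    exists (fun n => u n * v n) => [n|]; first exact: (Yop (0, Some false)).
    exact: cvg_mul.
  by apply/funext => z; rewrite /= (rep_mul rep).
- move=> _ T' [x [u uY ux] <-] adj; exists (star x).
    exists (fun n => star (u n)) => [n|]; last exact: cvg_star.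
    exact: (Yop (0, Some true) (u n) (u n)).
  apply/funext => z; apply/eqP; rewrite -subr_eq0; apply/eqP/inner_eq0.
  by rewrite innerBr -(rep_star rep) adj subrr.
- move=> T' T'W.
  have [b bT'] : exists b, iota b = T'.
    suff : cstar_generated G T' by rewrite -AG => -[b _ <-]; exists b.
    move=> Z [Zalg GZ]; have [_ _ _ _ Zc] := Zalg; apply: Zc => e e0.
    have [_ [b Wb <-] bT'] := T'W e e0; exists (iota b) => //.
    have : cstar_generated G (iota b) by rewrite -AG; exists b.
    exact.
  exists b => //; apply/dense_seqP => e e0.
  have e2 : 0 < e / 2 by exact: divr_gt0.
  have [_ [d /dense_seqP Wd <-] dT'] := T'W _ e2.
  have [y Yy dy] := Wd _ e2; exists y => //.
  rewrite -(subrKA d) [e]splitr (le_lt_trans (ler_normD _ _))// ler_ltD//.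
  apply: concrete_norm_le; first exact: ltW.
  by move=> x; rewrite (repB rep) bT'.
Qed.

End Generated.

(** * The direct sum representation *)

Section DirectSum.
Context (R : realType) (C : CARalgebra R) (D : pureStateData C)
  (H : hilbertType R) (V : forall i : psI D, ps_H i -> H)
  (V_sum : is_hilbert_sum V).
Implicit Types i k : psI D.

Definition zeta i : H := V (ps_xi i).

Lemma zeta_unit i : inner (zeta i) (zeta i) = 1.
Proof.
have [_ V_iso _ _] := V_sum; rewrite V_iso.
exact: (zero_state_unit (ps_phi_r D) (ps_alpha_GNS i)).
Qed.

Lemma zeta_orth i k : i <> k -> inner (zeta i) (zeta k) = 0.
Proof. by move=> ik; have [_ _ V_orth _] := V_sum; exact: V_orth. Qed.

Lemma zeta_norm i : `|zeta i| = 1.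
Proof. by apply/eqP; rewrite -(@eqrXn2 _ 2)// -innerxx zeta_unit expr1n. Qed.

Lemma zeta_dist i k : i <> k -> 1 <= `|zeta i - zeta k|.
Proof.
move=> ik; have := cauchy_schwarz (zeta i - zeta k) (zeta i).
rewrite innerBl zeta_unit (zeta_orth (nesym ik)) subr0 normr1.
by rewrite zeta_norm mulr1.
Qed.

Lemma le_continuum_sum : le_continuum (linear_span (\bigcup_i range (@V i))).
Proof.
apply/le_continuum_span/le_continuum_bigcup => [|i _].
  exact: le_continuum_index.
apply: le_continuum_image; have [_ Dd _] := ps_GNS i.
apply: (le_continuum_dense Dd); apply: le_continuum_image.
exact: le_continuum_CAR.
Qed.

Context (Pi : C -> H -> H) (Pi_rep : is_representation Pi)
  (Pi_sum : forall i (a : C) (x : ps_H i), Pi a (V x) = V (ps_pi a x))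
  (S : psI D -> H -> H)
  (S_lim : forall i (x : H), Pi (s_ i N) x @[N --> \oo] --> S i x).

(** The ranges of the [w_(i,n)] lie below the [f_n], which kill the vector of
    the distinguished state. *)
Lemma S_orth i x : inner (S i x) (zeta (psr D)) = 0.
Proof.
have phi0 := ps_phi_r D; have gns := ps_GNS (psr D).
have [V_lin _ _ _] := V_sum; have rep := ps_rep (psr D).
have w0 n : Pi (star (ps_w i n)) (zeta (psr D)) = 0.
  rewrite /zeta Pi_sum (_ : ps_pi _ _ = 0) ?(lin_zero (V_lin _))//.
  apply: inner_eq0; rewrite (inner_rep rep) starK ps_w_range /f_ (repB rep).
  by rewrite !(q_fix phi0 gns) subrr inner0l.
apply: (@seq_lim_unique _ _ (fun N => inner (Pi (s_ i N) x) (zeta (psr D)))).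
  exact: cvg_inner.
rewrite (_ : (fun N => _) = fun=> 0); first exact: cvg_cst.
apply/funext => N; rewrite /s_ (lin_sum (rep_linear Pi_rep x)) inner_suml.
by rewrite big1// => n _; rewrite (rep_adj Pi_rep) w0 inner0r.
Qed.

Lemma L_zeta i k :
  inner (L_ V S i (zeta k)) (zeta (psr D)) = inner (zeta k) (zeta i).
Proof.
rewrite /L_ innerDl S_orth add0r /theta_op innerZl -/(zeta _).
by rewrite zeta_unit mulr1.
Qed.

(** The operators are told apart by their matrix coefficients from [zeta i] to
    the distinguished vector. *)
Lemma L_separated (A : cstarAlgType R) (iota : A -> H -> H) (G : set (H -> H))
    (l : psI D -> A) :
  is_concrete_cstar iota (cstar_generated G) ->
  (forall i, iota (l i) = L_ V S i) ->
  forall i k, i <> k -> 1 <= `|l i - l k|.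
Proof.
move=> A_def lL i k ik; have [rep _ _] := A_def.
have := cauchy_schwarz (iota (l i - l k) (zeta i)) (zeta (psr D)).
rewrite (repB rep) !lL innerBl !L_zeta zeta_unit zeta_orth// subr0 normr1.
move=> /le_trans; apply; rewrite zeta_norm mulr1 -!lL -(repB rep).
by rewrite (le_trans (concrete_vec_le A_def _ _))// zeta_norm mulr1.
Qed.

End DirectSum.

Theorem corollary6p2 (R : realType) (C : CARalgebra R) (D : pureStateData C)
  (H : hilbertType R) (V : forall i : psI D, ps_H i -> H)
  (V_sum : is_hilbert_sum V)
  (Pi : C -> H -> H) (Pi_rep : is_representation Pi)
  (Pi_sum : forall (i : psI D) (a : C) (x : ps_H i),
     Pi a (V i x) = V i (ps_pi a x))
  (S : psI D -> H -> H)
  (S_lim : forall (i : psI D) (x : H), Pi (s_ i N) x @[N --> \oo] --> S i x)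
  (A : cstarAlgType R) (iota : A -> H -> H)
  (A_def : is_concrete_cstar iota
     (cstar_generated (range Pi `|` range (L_ V S))))
  (j : C -> A) (j_def : forall a : C, iota (j a) = Pi a)
  (tau : C -> R[i]) (tau_trace : is_CAR_trace tau)
  (ttau : A -> R[i]) (ttau_trace : is_tracial_state ttau)
  (K : hilbertType R) (rho : A -> K -> K) (Omega : K)
  (K_GNS : is_GNS_triple ttau rho Omega)
  (Htau : hilbertType R) (pitau : C -> Htau -> Htau) (Omegatau : Htau)
  (Htau_GNS : is_GNS_triple tau pitau Omegatau)
  (U : Htau -> K) (U_unitary : is_unitary_op U)
  (U_def : forall b : C, U (pitau b Omegatau) = rho (j b) Omega) :
  [/\ [set: A] #= continuum,
      density_character_eq A continuum,
      density_character_eq H continuum,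
      separable_space Htau
    & infinite_dimensional Htau]
  /\ (exists2 B : set Htau, orthonormal_basis B & B #= [set: nat])
  /\ (forall B : set H, orthonormal_basis B -> B #= continuum).
Proof.
have [g g_inj] := continuum_index D.
have g_neq x y : x <> y -> g x <> g y by move=> xy /g_inj.
have Htau_sep := GNS_separable Htau_GNS.
have Htau_inf := trace_infinite_dimensional tau_trace Htau_GNS.
have [_ _ _ V_dense] := V_sum.
have leH := le_continuum_dense V_dense (le_continuum_sum V).
have zeta_g x y : x <> y -> 1 <= `|zeta V (g x) - zeta V (g y)|.
  by move=> /g_neq; exact: (zeta_dist V_sum).
have [_ dens_H] := density_continuum ltr01 zeta_g V_dense (le_continuum_sum V).
have leA : le_continuum [set: A].
  apply: (le_continuum_generated A_def).
  pose F (b : bool) := if b then range Pi else range (L_ V S).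
  apply: (@le_continuum_sub _ _ (\bigcup_b F b)).
    by move=> T [T1|T2]; [exists true|exists false].
  apply: le_continuum_bigcup => [|[] _ /=]; first exact: le_continuum_bool.
    by apply: le_continuum_image; exact: le_continuum_CAR.
  by apply: le_continuum_image; exact: le_continuum_index.
have /choice[l lL] i : exists a, iota a = L_ V S i.
  by apply: (generated_concrete A_def); right; exists i.
have l_g x y : x <> y -> 1 <= `|l (g x) - l (g y)|.
  by move=> /g_neq; exact: (L_separated V_sum Pi_rep Pi_sum S_lim A_def lL).
have A_dense : dense [set: A].
  by apply/dense_approxP => x e e0; exists x; rewrite // subrr normr0.
have [card_A dens_A] := density_continuum ltr01 l_g A_dense leA.
split; first by split.
split; first exact: separable_orthonormal_basis.
move=> B B_on; apply: card_continuum; first exact: le_continuum_sub leH.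
apply: (orthonormal_basis_continuum (z := fun x => zeta V (g x))) B_on
  => [x|x y].
  exact: (zeta_unit V_sum).
by move=> /g_neq; exact: (zeta_orth V_sum).
Qed.
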